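(* Let $\Gamma,\Sigma,\Lambda,C>0$ and $\beta\ge1/2$. Let $\mathcal{T}$ be the collection of all Lévy triplets $T=(\gamma,\sigma^2,\rho)$ such that $|\gamma|\le\Gamma$, $\sigma\in(0,\Sigma]$, $\lambda\in(0,\Lambda]$ and $$\int_{-\infty}^{\infty}|t|^{2\beta}|\phi_f(t)|^2\,dt\le C .$$ Then there exist a constant $c>0$ and an integer $n_0$ such that for all $n\ge n_0$ $$\inf_{\widetilde\rho_n}\ \sup_{\mathcal{T}}\ \operatorname{MISE}[\widetilde\rho_n]\ge c(\log n)^{-\beta},$$ where the infimum is taken over all estimators $\widetilde\rho_n$ of $\rho$ based on observations $X_1,\dots,X_n$.
   Context: A triplet $(\gamma,\sigma^2,\rho)$ consists of $\gamma\in\mathbb{R}$, $\sigma\ge0$ and a Lévy density $\rho:\mathbb{R}\to[0,\infty)$ with $0<\lambda:=\int_{-\infty}^{\infty}\rho(x)\,dx<\infty$; write $f=\rho/\lambda$ (a probability density) and $\phi_f(t)=\int e^{itx}f(x)\,dx$. Under this triplet, $X_1,\dots,X_n$ are i.i.d. copies of a random variable $X$ with characteristic function $$\phi_X(t)=\exp\Bigl[i\gamma t-\tfrac12\sigma^2t^2+\int_{\mathbb{R}}(e^{itx}-1)\rho(x)\,dx\Bigr].$$ $\operatorname{MISE}[\widetilde\rho_n]=\operatorname{E}\bigl[\int_{-\infty}^{\infty}|\widetilde\rho_n(x)-\rho(x)|^2dx\bigr]$, the expectation being under the law determined by the triplet. An estimator is a measurable function of the observations. The constant $c$ does not depend on $n$.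 *)

(* Defs.v *)
From HB Require Import structures.
From mathcomp Require Import all_boot all_order all_algebra.
From mathcomp Require Import complex.
From mathcomp Require Import all_classical all_reals all_analysis.
Set Implicit Arguments.
Unset Strict Implicit.
Unset Printing Implicit Defensive.
Import Order.TTheory GRing.Theory Num.Theory.
Import numFieldNormedType.Exports.

Local Open Scope classical_set_scope.
Local Open Scope ring_scope.
Local Open Scope complex_scope.

Section complex_analysis.
Context {R : realType}.

Definition cexp (z : R[i]) : R[i] :=
  (expR (complex.Re z) * cos (complex.Im z))
  +i* (expR (complex.Re z) * sin (complex.Im z)).

Definition cintegral d (T : measurableType d) (mu : {measure set T -> \bar R})
    (g : T -> R[i]) : R[i] :=
  (\int[mu]_x complex.Re (g x)) +i* (\int[mu]_x complex.Im (g x)).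

End complex_analysis.

(* The Gaussian part is stored through sigma >= 0 rather than sigma ^+ 2. *)
Record levy_triplet (R : realType) := LevyTriplet {
  drift : R;
  sigma : R;
  ldens : R -> R;
  sigma_ge0 : 0 <= sigma;
  ldens_ge0 : forall x, 0 <= ldens x;
  ldens_measurable : measurable_fun setT ldens;
  ldens_gt0 : (0 < \int[lebesgue_measure]_x (ldens x)%:E)%E;
  ldens_fin : (\int[lebesgue_measure]_x (ldens x)%:E < +oo)%E }.

Section levy.
Context {R : realType}.
Local Notation mu := (@lebesgue_measure R).
Implicit Type T : levy_triplet R.

Definition intensity T : R := \int[mu]_x ldens T x.

Definition jump_density T (x : R) : R := ldens T x / intensity T.

Definition jump_charfun T (t : R) : R[i] :=
  cintegral mu (fun x => cexp (0 +i* (t * x)) * (jump_density T x)%:C).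

Definition levy_charfun T (t : R) : R[i] :=
  cexp ((0 +i* (drift T * t))
        - (2^-1 * sigma T ^+ 2 * t ^+ 2)%:C
        + cintegral mu (fun x => (cexp (0 +i* (t * x)) - 1) * (ldens T x)%:C)).

Definition triplet_class (Gamma Sigma Lambda C beta : R) : set (levy_triplet R) :=
  [set T | [/\ `|drift T| <= Gamma,
               0 < sigma T <= Sigma,
               0 < intensity T <= Lambda &
               (\int[mu]_t (`|t| `^ (2 * beta)
                             * Normc.normc (jump_charfun T t) ^+ 2)%:E
                <= C%:E)%E]].

End levy.

Section sampling.
Context {R : realType}.

Definition charfun d (Omega : measurableType d) (P : probability Omega R)
    (X : {RV P >-> R}) (t : R) : R[i] :=
  cintegral P (fun w => cexp (0 +i* (t * X w))).

Definition mutually_independent d (Omega : measurableType d)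
    (P : probability Omega R) n (X : 'I_n -> {RV P >-> R}) : Prop :=
  forall (J : {set 'I_n}) (A : 'I_n -> set R),
    (forall i, measurable (A i)) ->
    P [set w | forall i, i \in J -> A i (X i w)]
    = (\prod_(i in J) P (X i @^-1` A i))%E.

Definition identically_distributed d (Omega : measurableType d)
    (P : probability Omega R) n (X : 'I_n -> {RV P >-> R}) : Prop :=
  forall i j (A : set R), measurable A ->
    distribution P (X i) A = distribution P (X j) A.

Definition iid_sample (T : levy_triplet R) d (Omega : measurableType d)
    (P : probability Omega R) n (X : 'I_n -> {RV P >-> R}) : Prop :=
  [/\ mutually_independent X,
      identically_distributed X &
      forall i t, charfun (X i) t = levy_charfun T t].

(* [est (xs, x)] is the value at [x] of the estimate computed from the
   observations [xs]; joint measurability makes the integrated squared error a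
   random variable. *)
Definition estimator n := {mfun (n.-tuple R * R)%type >-> R}.

Definition MISE (T : levy_triplet R) d (Omega : measurableType d)
    (P : probability Omega R) n (X : 'I_n -> {RV P >-> R})
    (est : estimator n) : \bar R :=
  (\int[P]_w \int[lebesgue_measure]_x
     (`|est ([tuple X i w | i < n], x) - ldens T x| ^+ 2)%:E)%E.

(* The MISE depends on the sample only through its law, which the triplet
   determines; ranging over all the models of the sample therefore attaches to
   each triplet a single value. *)
Definition sup_MISE (F : set (levy_triplet R)) n (est : estimator n) : \bar R :=
  ereal_sup [set m | exists (T : levy_triplet R) (d : measure_display)
      (Omega : measurableType d) (P : probability Omega R)
      (X : 'I_n -> {RV P >-> R}),
      [/\ F T, iid_sample T X & m = MISE T X est]].

Definition minimax_MISE (F : set (levy_triplet R)) n : \bar R :=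
  ereal_inf [set sup_MISE F est | est in [set: estimator n]].

End sampling.

(* Main.v *)
(* Two-point argument of Le Cam. Both hypotheses have no drift, Gaussian part
   [Sigma], intensity [Lambda], and jump density [g] or
   [g (1 + a (cos (m x) - e))], where [g] is a centred Gaussian density whose
   large width makes the Sobolev norm small, and [a] is of order [m^(-beta)]:
   the two Levy densities are at squared L2-distance of order [m^(-2 beta)].
   Convolution with the Gaussian component damps the oscillation by a factor
   [exp (- v m^2 / 2)], which therefore bounds, up to constants, the distance in
   total variation between the two laws of one observation. Choosing [m^2]
   proportional to [log n] makes the n-fold product laws indistinguishable.
   All the laws are symmetric, hence their characteristic functions are real,
   and the law of an observation is an explicit Poisson mixture of convolution
   powers, so that no Fourier inversion is needed. *)
Require Import Defs.
From HB Require Import structures.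
From mathcomp Require Import all_boot all_order all_algebra.
From mathcomp Require Import complex ring lra.
From mathcomp Require Import all_classical all_reals all_analysis.
From mathcomp Require Import measurable_realfun.
Set Implicit Arguments.
Unset Strict Implicit.
Unset Printing Implicit Defensive.
Import Order.TTheory GRing.Theory Num.Theory.
Import numFieldNormedType.Exports.
Local Open Scope classical_set_scope.
Local Open Scope ring_scope.
Local Open Scope complex_scope.

(** * Gaussian integrals *)

Section lebesgue_invariance.
Context {R : realType}.
Local Notation mu := (@lebesgue_measure R).
Implicit Types (f : R -> \bar R) (c : R).

(** The Gaussian envelope of the jump density keeps every computation explicit. Given the sum of the
    Gaussian component and one unmodulated jump, the jump is again Gaussian, with variance
    [v = s^2 t^2 / (s^2 + t^2)] where [s] and [t] are the two standard deviations; the damping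
    factor is the modulus of the characteristic function of this conditional law at frequency [m].
    The width [t] is fixed by [C] and [beta] alone, so [v] and the separation constants do not move
    with [n]; only [m] and [a] do.

    The bound for one jump passes to the sample by successive exchanges: [k] jumps cost a factor
    [k], Poisson mixing turns it into [expR lam], and [n] observations cost a factor [n]. A damping
    of order [n^(-2)] therefore leaves a total error of order [1/n].

    An i.i.d. sample is specified through the characteristic function of its entries, and [sup_MISE]
    ranges over all models. A lower bound thus needs only one explicit model per hypothesis, and no
    uniqueness theorem for characteristic functions. *)

Lemma ge0_integral_comp_preserving (phi : R -> measurableTypeR R) f :
  measurable_fun [set: R] phi ->
  (forall A, measurable A -> pushforward mu phi A = mu A) ->
  measurable_fun [set: R] f -> (forall x, (0 <= f x)%E) ->
  (\int[mu]_x f (phi x) = \int[mu]_x f x)%E.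
Proof.
move=> mphi phimu mf f0.
rewrite -[LHS](@ge0_integral_pushforward _ _ (measurableTypeR R)
  (measurableTypeR R) _ phi mphi mu setT f)//.
by apply: eq_measure_integral => A mA _; exact: phimu.
Qed.

Lemma integral_comp_preserving (phi : R -> measurableTypeR R) f :
  measurable_fun [set: R] phi ->
  (forall A, measurable A -> pushforward mu phi A = mu A) ->
  measurable_fun [set: R] f ->
  (\int[mu]_x f (phi x) = \int[mu]_x f x)%E.
Proof.
move=> mphi phimu mf; rewrite integralE [RHS]integralE.
rewrite -(ge0_integral_comp_preserving mphi phimu (measurable_funepos mf))//.
rewrite -(ge0_integral_comp_preserving mphi phimu (measurable_funeneg mf))//.
by congr (_ - _)%E; apply: eq_integral => x _; rewrite ?funeposE ?funenegE.
Qed.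

Lemma integral_shift c f : measurable_fun [set: R] f ->
  (\int[mu]_x f (x + c)%R = \int[mu]_x f x)%E.
Proof.
apply: (@integral_comp_preserving (fun x : R => x + c : measurableTypeR R)).
  exact: measurable_funD.
have mD : @measurable_fun _ _ (measurableTypeR R) (measurableTypeR R) setT
    (fun x : R => x + c) by exact: (@measurable_funD _ R).
move=> A mA; apply/esym/lebesgue_measure_unique => //= _ [[a b]] _ <-.
rewrite /pushforward.
rewrite (_ : _ @^-1` _ = [set` `]a - c, b - c]]); last first.
  by apply/seteqP; split=> x /=; rewrite !in_itv/= ltrBlDr lerBrDr.
rewrite !lebesgue_measure_itv/= !lte_fin ltrD2r.
by case: ifP => // _; rewrite -!EFinB; congr EFin; ring.
Qed.

Lemma integral_oppr f : measurable_fun [set: R] f ->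
  (\int[mu]_x f (- x)%R = \int[mu]_x f x)%E.
Proof.
apply: (@integral_comp_preserving (-%R : R -> measurableTypeR R)) => //.
by move=> A mA; exact: lebesgue_measureN.
Qed.

Lemma Rintegral_shift c (f : R -> R) : measurable_fun [set: R] f ->
  \int[mu]_x f (x + c) = \int[mu]_x f x.
Proof.
move=> mf; rewrite /Rintegral -(@integral_shift c (EFin \o f))//.
exact/measurable_EFinP.
Qed.

Lemma Rintegral_odd (f : R -> R) : measurable_fun [set: R] f ->
  mu.-integrable setT (EFin \o f) ->
  (forall x, f (- x) = - f x) -> \int[mu]_x f x = 0.
Proof.
move=> mf fi fN.
have : \int[mu]_x f (- x) = \int[mu]_x f x.
  rewrite /Rintegral -(@integral_oppr (EFin \o f))//.
  exact/measurable_EFinP.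
under eq_Rintegral do rewrite fN -mulN1r.
by rewrite RintegralZl// mulN1r; lra.
Qed.

End lebesgue_invariance.

Section integrable_real.
Context d (T : measurableType d) (R : realType).
Variables (mu : {measure set T -> \bar R}) (D : set T).
Hypothesis mD : measurable D.
Implicit Types f g : T -> R.

Lemma EFin_Rintegral f : mu.-integrable D (EFin \o f) ->
  (\int[mu]_(x in D) (f x)%:E = (\int[mu]_(x in D) f x)%:E)%E.
Proof. by move=> fi; rewrite /Rintegral fineK//; exact: integrable_fin_num. Qed.

Lemma integrable_EFinZ (c : R) f : mu.-integrable D (EFin \o f) ->
  mu.-integrable D (EFin \o (fun x => c * f x)).
Proof.
move=> fi; rewrite /comp; under eq_fun do rewrite EFinM.
exact: integrableZl.
Qed.

Lemma integrable_EFinD f g : mu.-integrable D (EFin \o f) ->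
  mu.-integrable D (EFin \o g) -> mu.-integrable D (EFin \o (fun x => f x + g x)).
Proof.
move=> fi gi; rewrite /comp; under eq_fun do rewrite EFinD.
exact: integrableD.
Qed.

Lemma integrable_EFinB f g : mu.-integrable D (EFin \o f) ->
  mu.-integrable D (EFin \o g) -> mu.-integrable D (EFin \o (fun x => f x - g x)).
Proof.
move=> fi gi; rewrite /comp; under eq_fun do rewrite EFinB.
exact: integrableB.
Qed.

End integrable_real.

(** * Characteristic function of the Gaussian law *)

Section gaussian.
Context {R : realType}.
Local Notation mu := (@lebesgue_measure R).
Implicit Types (m s t x h : R).

(** Domination is required only within distance 1 of [a]. This locality matters for the exponential
    tilt below, whose derivative has no integrable bound uniform in the parameter. *)
Lemma is_derive_under_integral (f df : R -> R -> R) (G : R -> R) (a : R) :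
  (forall u, mu.-integrable setT (EFin \o f u)) ->
  (forall u x : R, is_derive u 1 (f ^~ x) (df u x)) ->
  mu.-integrable setT (EFin \o G) ->
  (forall u x, `|u - a| < 1 -> `|df u x| <= G x) ->
  is_derive a 1 (fun u => \int[mu]_x f u x) (\int[mu]_x df a x).
Proof.
move=> fi fd Gi dfG.
have G0 x : 0 <= G x.
  by apply: le_trans (dfG a x _); rewrite ?subrr ?normr0.
have p1 u x : partial1of2 f u x = df u x.
  by rewrite partial1of2E; apply: derive_val.
have Ia : `](a - 1), (a + 1)[%classic a by rewrite /= in_itv/=; lra.
have p1G u x : `](a - 1), (a + 1)[%classic u -> [set: R] x ->
    `|partial1of2 f u x| <= G x.
  rewrite /= in_itv/= => ua _; rewrite p1; apply: dfG.
  by rewrite ltr_norml; lra.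
have fd' u x : `](a - 1), (a + 1)[%classic u -> [set: R] x ->
  derivable (f ^~ x) u 1 by move=> _ _; exact: ex_derive.
apply: DeriveDef.
  exact: (derivable_under_integral measurableT Ia (fun u _ => fi u) fd' G0 Gi).
rewrite -derive1E.
rewrite (differentiation_under_integral measurableT Ia (fun u _ => fi u) fd' G0 Gi)//.
by apply: eq_Rintegral => x _; rewrite p1.
Qed.

Lemma integrable_normal_pdfM m s (b : R -> R) (M : R) :
  measurable_fun setT b -> (forall x, `|b x| <= M) ->
  mu.-integrable setT (EFin \o (fun x => normal_pdf m s x * b x)).
Proof.
move=> mb bM; apply: (@le_integrable _ _ _ mu setT measurableT _
    (fun x => M%:E * (normal_pdf m s x)%:E)%E).
- by apply/measurable_EFinP/measurable_funM => //; exact: measurable_normal_pdf.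
- move=> x _ /=; rewrite lee_fin !normrM mulrC ler_wpM2r//.
  by rewrite (le_trans (bM x))// ler_norm.
- by apply: integrableZl => //; exact: integrable_normal_pdf.
Qed.

Lemma normal_pdf_center m s x : s != 0 ->
  normal_pdf m s x = normal_pdf 0 s (x - m).
Proof. by move=> s0; rewrite !normal_pdfE// /normal_fun subr0. Qed.

(** Completing the square. The identity makes exponential moments integrable, and it is also the
    device from which the characteristic function is derived. *)
Lemma normal_pdf_tilt s h x : s != 0 ->
  normal_pdf 0 s x * expR (h * x) =
  expR (s ^+ 2 * h ^+ 2 / 2) * normal_pdf (s ^+ 2 * h) s x.
Proof.
move=> s0; rewrite !normal_pdfE// /normal_fun -[LHS]mulrA [RHS]mulrCA -!expRD.
by congr (_ * expR _); field.
Qed.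

Lemma measurable_cosM t : measurable_fun setT (fun x : R => cos (t * x)).
Proof.
apply: measurableT_comp; last exact: measurable_funM.
apply: continuous_measurable_fun; exact: continuous_cos.
Qed.

Lemma measurable_sinM t : measurable_fun setT (fun x : R => sin (t * x)).
Proof.
apply: measurableT_comp; last exact: measurable_funM.
apply: continuous_measurable_fun; exact: continuous_sin.
Qed.

Lemma Rintegral_normal_pdf m s : \int[mu]_x normal_pdf m s x = 1.
Proof. by rewrite /Rintegral integral_normal_pdf. Qed.

Lemma Rintegral_normal_center m s (b : R -> R) : s != 0 ->
  measurable_fun setT b ->
  \int[mu]_x (normal_pdf m s x * b x) =
  \int[mu]_x (normal_pdf 0 s x * b (x + m)).
Proof.
move=> s0 mb; rewrite -(@Rintegral_shift _ m); last first.
  by apply: measurable_funM => //; exact: measurable_normal_pdf.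
by apply: eq_Rintegral => x _; rewrite normal_pdf_center// addrK.
Qed.

Lemma normal_pdfN s x : s != 0 -> normal_pdf 0 s (- x) = normal_pdf 0 s x.
Proof. by move=> s0; rewrite !normal_pdfE// /normal_fun !subr0 sqrrN. Qed.

Lemma integrable_normal_cos m s t :
  mu.-integrable setT (EFin \o (fun x => normal_pdf m s x * cos (t * x))).
Proof.
apply: (@integrable_normal_pdfM _ _ _ 1) => [|x]; first exact: measurable_cosM.
exact: cos_max.
Qed.

Lemma integrable_normal_sin m s t :
  mu.-integrable setT (EFin \o (fun x => normal_pdf m s x * sin (t * x))).
Proof.
apply: (@integrable_normal_pdfM _ _ _ 1) => [|x]; first exact: measurable_sinM.
exact: sin_max.
Qed.

Lemma Rintegral_normal_sin s t : s != 0 ->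
  \int[mu]_x (normal_pdf 0 s x * sin (t * x)) = 0.
Proof.
move=> s0; apply: Rintegral_odd; last 2 first.
- exact: integrable_normal_sin.
- by move=> x; rewrite normal_pdfN// mulrN sinN mulrN.
by apply: measurable_funM; [exact: measurable_normal_pdf|exact: measurable_sinM].
Qed.

(* Dominates the derivatives, with respect to the parameter, of the two
   parameterized integrals below. *)
Let G s x := expR (s ^+ 2 * 2 ^+ 2 / 2) *
  (normal_pdf (s ^+ 2 * 2) s x + normal_pdf (s ^+ 2 * - 2) s x).

Let GE s x : s != 0 ->
  G s x = normal_pdf 0 s x * (expR (2 * x) + expR (- 2 * x)).
Proof.
by move=> s0; rewrite mulrDr !normal_pdf_tilt// sqrrN -mulrDr.
Qed.

Let normrM_expR_le x : `|x| * expR `|x| <= expR (2 * x) + expR (- 2 * x).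
Proof.
apply: (@le_trans _ _ (expR (2 * `|x|))).
  rewrite mulr_natl mulr2n expRD ler_wpM2r ?expR_ge0//.
  by apply: le_trans (expR_ge1Dx _); lra.
have [x0|x0] := leP 0 x; first by rewrite ger0_norm// lerDl expR_ge0.
by rewrite ltr0_norm// mulrN -mulNr lerDr expR_ge0.
Qed.

Let integrable_G s : mu.-integrable setT (EFin \o G s).
Proof.
apply: (@eq_integrable _ _ _ mu setT measurableT (
  fun x => (expR (s ^+ 2 * 2 ^+ 2 / 2))%:E *
  ((normal_pdf (s ^+ 2 * 2) s x)%:E + (normal_pdf (s ^+ 2 * - 2) s x)%:E))%E).
  by move=> x _; rewrite /= -EFinD -EFinM.
apply: integrableZl => //; apply: integrableD => //; exact: integrable_normal_pdf.
Qed.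

Let norm_xsin_le s t x : s != 0 ->
  `|normal_pdf 0 s x * (x * sin (t * x))| <= G s x.
Proof.
move=> s0; rewrite GE// normrM ger0_norm ?normal_pdf_ge0//.
rewrite ler_wpM2l ?normal_pdf_ge0//; apply: le_trans (normrM_expR_le x).
rewrite normrM ler_wpM2l// (le_trans (sin_max _))//.
by rewrite -expR0 ler_expR.
Qed.

Let integrable_normal_xsin s t : s != 0 -> mu.-integrable setT
  (EFin \o (fun x => normal_pdf 0 s x * (x * sin (t * x)))).
Proof.
move=> s0; apply: (@le_integrable _ _ _ mu setT measurableT _ (EFin \o G s)) => //.
  apply/measurable_EFinP; apply: measurable_funM => //.
    exact: measurable_normal_pdf.
  by apply: measurable_funM => //; exact: measurable_sinM.
move=> x _ /=; rewrite lee_fin (le_trans (norm_xsin_le _ _ s0))//.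
exact: ler_norm.
Qed.

Let is_derive_cos_normal s t : s != 0 ->
  is_derive t 1 (fun t => \int[mu]_x (normal_pdf 0 s x * cos (t * x)))
    (\int[mu]_x (normal_pdf 0 s x * (- x * sin (t * x)))).
Proof.
move=> s0.
apply: (@is_derive_under_integral (fun t x => normal_pdf 0 s x * cos (t * x))
  (fun t x => normal_pdf 0 s x * (- x * sin (t * x))) (G s)) => //.
- by move=> u; exact: integrable_normal_cos.
- move=> u x.
  have := @is_derive_eq _ _ _ (cst (normal_pdf 0 s x) * (cos \o (id * cst x))) u 1
    (normal_pdf 0 s x * (- x * sin (u * x))) _ _.
  apply; rewrite /= /cst /GRing.scale/=; ring.
by move=> u x _; rewrite mulNr mulrN normrN; exact: norm_xsin_le.
Qed.

Let is_derive_sin_normal s t : s != 0 ->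
  is_derive (0 : R) 1
    (fun h => \int[mu]_x (normal_pdf 0 s x * (expR (h * x) * sin (t * x))))
    (\int[mu]_x (normal_pdf 0 s x * (x * sin (t * x)))).
Proof.
move=> s0.
have -> : \int[mu]_x (normal_pdf 0 s x * (x * sin (t * x))) =
    \int[mu]_x (normal_pdf 0 s x * (x * expR (0 * x) * sin (t * x))).
  by apply: eq_Rintegral => x _; rewrite mul0r expR0 mulr1.
apply: (@is_derive_under_integral
  (fun h x => normal_pdf 0 s x * (expR (h * x) * sin (t * x)))
  (fun h x => normal_pdf 0 s x * (x * expR (h * x) * sin (t * x))) (G s)) => //.
- move=> u; apply: (@eq_integrable _ _ _ mu setT measurableT (fun x =>
    (expR (s ^+ 2 * u ^+ 2 / 2))%:E *
    (normal_pdf (s ^+ 2 * u) s x * sin (t * x))%:E)%E).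
    move=> x _; rewrite -EFinM /comp; congr EFin.
    by rewrite mulrA -(normal_pdf_tilt _ _ s0) mulrA.
  by apply: integrableZl => //; exact: integrable_normal_sin.
- move=> u x.
  have := @is_derive_eq _ _ _
    (cst (normal_pdf 0 s x) * ((expR \o (id * cst x)) * cst (sin (t * x)))) u 1
    (normal_pdf 0 s x * (x * expR (u * x) * sin (t * x))) _ _.
  apply; rewrite /= /cst /GRing.scale/=; ring.
move=> u x; rewrite subr0 => u1; rewrite GE// normrM ger0_norm ?normal_pdf_ge0//.
rewrite ler_wpM2l ?normal_pdf_ge0//; apply: le_trans (normrM_expR_le x).
rewrite !normrM -[leRHS]mulr1 ler_pM ?mulr_ge0// ?sin_max// ler_wpM2l//.
rewrite ger0_norm ?expR_ge0// ler_expR (le_trans (ler_norm _))// normrM.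
by rewrite ler_piMl// ltW.
Qed.

Let Rintegral_normal_tilt_sin s t h : s != 0 ->
  \int[mu]_x (normal_pdf 0 s x * (expR (h * x) * sin (t * x))) =
  expR (s ^+ 2 * h ^+ 2 / 2) * (sin (t * (s ^+ 2 * h)) *
    \int[mu]_x (normal_pdf 0 s x * cos (t * x))).
Proof.
move=> s0.
transitivity (\int[mu]_x (expR (s ^+ 2 * h ^+ 2 / 2) *
    (normal_pdf (s ^+ 2 * h) s x * sin (t * x)))).
  by apply: eq_Rintegral => x _; rewrite mulrA normal_pdf_tilt// [RHS]mulrA.
rewrite RintegralZl//; last exact: integrable_normal_sin.
congr (_ * _); rewrite Rintegral_normal_center//; last exact: measurable_sinM.
transitivity (\int[mu]_x (cos (t * (s ^+ 2 * h)) * (normal_pdf 0 s x * sin (t * x)) +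
    sin (t * (s ^+ 2 * h)) * (normal_pdf 0 s x * cos (t * x)))).
  by apply: eq_Rintegral => x _; rewrite mulrDr sinD; ring.
rewrite RintegralD//; last 2 first.
- by apply: integrable_EFinZ => //; exact: integrable_normal_sin.
- by apply: integrable_EFinZ => //; exact: integrable_normal_cos.
rewrite !RintegralZl//; [|exact: integrable_normal_cos|exact: integrable_normal_sin].
by rewrite Rintegral_normal_sin// mulr0 add0r.
Qed.

(* The tilting identity evaluates E[exp(hX) sin(tX)]; its derivative at h = 0
   gives E[X sin(tX)], which replaces an integration by parts on the line. *)
Let is_derive_cos_normalE s t : s != 0 ->
  is_derive t 1 (fun t => \int[mu]_x (normal_pdf 0 s x * cos (t * x)))
    (- (s ^+ 2 * t * \int[mu]_x (normal_pdf 0 s x * cos (t * x)))).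
Proof.
move=> s0; set F := (fun t => _).
suff EX : \int[mu]_x (normal_pdf 0 s x * (x * sin (t * x))) = s ^+ 2 * t * F t.
  apply: is_derive_eq (is_derive_cos_normal t s0) _.
  transitivity (- \int[mu]_x (normal_pdf 0 s x * (x * sin (t * x)))); last first.
    by rewrite EX.
  rewrite -mulN1r -RintegralZl//; last exact: integrable_normal_xsin.
  by apply: eq_Rintegral => x _; ring.
have d1 := is_derive_sin_normal t s0.
have d2 : is_derive (0 : R) 1
    (fun h => \int[mu]_x (normal_pdf 0 s x * (expR (h * x) * sin (t * x))))
    (s ^+ 2 * t * F t).
  under eq_fun do rewrite Rintegral_normal_tilt_sin//.
  have := @is_derive_eq _ _ _
    ((expR \o (cst (s ^+ 2) * (id * id) * cst 2^-1)) *
     ((sin \o (cst t * (cst (s ^+ 2) * id))) * cst (F t))) (0 : R) 1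
    (s ^+ 2 * t * F t) _ _.
  apply; rewrite /= /cst /GRing.scale/= !fctE /=.
  rewrite !(mulr0, mul0r, cos0, sin0, expR0); ring.
by rewrite -(@derive_val _ _ _ _ _ _ _ d1) (@derive_val _ _ _ _ _ _ _ d2).
Qed.

(** The integral [F] solves [F' = - s^2 t F] with [F 0 = 1], so its product with
    [expR (s^2 t^2 / 2)] has zero derivative and is constantly 1. *)
Let Rintegral_normal_cos0 s t : s != 0 ->
  \int[mu]_x (normal_pdf 0 s x * cos (t * x)) = expR (- (s ^+ 2 * t ^+ 2 / 2)).
Proof.
move=> s0; set F := (fun t => \int[mu]_x (normal_pdf 0 s x * cos (t * x))).
rewrite -/(F t).
have dF (u : R) : is_derive u 1 F (- (s ^+ 2 * u * F u)).
  exact: is_derive_cos_normalE.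
have dH (u : R) : is_derive u 1
    (F * (expR \o (cst (s ^+ 2) * (id * id) * cst 2^-1))) 0.
  by apply: is_derive_eq; rewrite /= /cst /GRing.scale/= !fctE /=; field.
have := is_derive_0_is_cst t 0 dH.
rewrite !fctE /= !(mulr0, mul0r) expR0 mulr1 => /(canRL (mulfK _)) ->; last first.
  by rewrite gt_eqF// expR_gt0.
rewrite -expRN expr2 {1}/F; under eq_Rintegral do rewrite mul0r cos0 mulr1.
by rewrite Rintegral_normal_pdf mul1r.
Qed.

Lemma Rintegral_normal_cos m s t : s != 0 ->
  \int[mu]_x (normal_pdf m s x * cos (t * x)) =
  cos (t * m) * expR (- (s ^+ 2 * t ^+ 2 / 2)).
Proof.
move=> s0; rewrite Rintegral_normal_center//; last exact: measurable_cosM.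
transitivity (\int[mu]_x (cos (t * m) * (normal_pdf 0 s x * cos (t * x)) -
    sin (t * m) * (normal_pdf 0 s x * sin (t * x)))).
  by apply: eq_Rintegral => x _; rewrite mulrDr cosD; ring.
rewrite RintegralB//; last 2 first.
- by apply: integrable_EFinZ => //; exact: integrable_normal_cos.
- by apply: integrable_EFinZ => //; exact: integrable_normal_sin.
rewrite !RintegralZl//; [|exact: integrable_normal_sin|exact: integrable_normal_cos].
by rewrite Rintegral_normal_sin// Rintegral_normal_cos0// mulr0 subr0.
Qed.

End gaussian.

(** * Laws with a density, convolution and total variation *)

Record pdensity (R : realType) := PDensity {
  dens :> R -> R;
  dens_ge0 : forall x, 0 <= dens x;
  measurable_dens : measurable_fun setT dens;
  integral_dens : (\int[lebesgue_measure]_x (dens x)%:E = 1)%E }.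

Definition dprob (R : realType) (f : pdensity R) : set _ -> \bar R :=
  fun A => (\int[lebesgue_measure]_(x in A) (f x)%:E)%E.

Section dprob.
Context {R : realType}.
Variable f : pdensity R.
Local Notation mu := (@lebesgue_measure R).

Lemma integrable_dens : mu.-integrable setT (EFin \o f).
Proof.
apply/integrableP; split; first by apply/measurable_EFinP; exact: measurable_dens.
under eq_integral => x _ do rewrite /= ger0_norm ?dens_ge0//.
by rewrite integral_dens ltry.
Qed.

Let dprob0 : dprob f set0 = 0%E.
Proof. by rewrite /dprob integral_set0. Qed.

Let dprob_ge0 A : (0 <= dprob f A)%E.
Proof. by apply: integral_ge0 => x _; rewrite lee_fin dens_ge0. Qed.

Let dprob_sigma_additive : semi_sigma_additive (dprob f).
Proof.
move=> /= A mA tA mUA.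
rewrite /dprob/= integral_bigcup//=; last first.
  by apply: (integrableS _ _ (subsetT _)) => //; exact: integrable_dens.
apply: is_cvg_ereal_nneg_natsum_cond => n _ _.
by apply: integral_ge0 => /= x ?; rewrite lee_fin dens_ge0.
Qed.

HB.instance Definition _ := isMeasure.Build _ _ _
  (dprob f) dprob0 dprob_ge0 dprob_sigma_additive.

Let dprob_setT : dprob f [set: _] = 1%E.
Proof. exact: integral_dens. Qed.

HB.instance Definition _ :=
  @Measure_isProbability.Build _ _ R (dprob f) dprob_setT.

Lemma dprob_dominates : dprob f `<< mu.
Proof.
apply/null_content_dominatesP => A mA muA0.
apply: null_set_integral => //; apply/measurable_EFinP/measurable_funTS.
exact: measurable_dens.
Qed.

Lemma ge0_integral_dprob (h : R -> \bar R) : measurable_fun setT h ->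
  (forall x, 0 <= h x)%E ->
  (\int[dprob f]_x h x = \int[mu]_x (h x * (f x)%:E))%E.
Proof.
move=> mh h0.
rewrite -(Radon_Nikodym_SigmaFinite.change_of_variables dprob_dominates)//.
have fi := Radon_Nikodym_SigmaFinite.f_integrable dprob_dominates.
have mrn := measurable_int _ fi.
apply: ae_eq_integral => //.
- exact: emeasurable_funM.
- by apply: emeasurable_funM => //; apply/measurable_EFinP; exact: measurable_dens.
(* The Radon-Nikodym derivative agrees almost everywhere with [f], because both have the same
   integral over every measurable set. *)
apply: ae_eqe_mul2l; apply: integral_ae_eq => //.
- by apply/measurable_EFinP; exact: measurable_dens.
- by move=> A _ mA; rewrite -Radon_Nikodym_SigmaFinite.f_integral//;
    exact: dprob_dominates.
Qed.

End dprob.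

(* [lebesgue_measure] lives on [measurableTypeR R], which carries the same
   sigma-algebra as [R] but another display. *)
Definition toR (R : realType) (x : measurableTypeR R) : R := x.

HB.instance Definition _ (R : realType) := isMeasurableFun.Build _ _
  (measurableTypeR R) R (@toR R) (@measurable_id _ (measurableTypeR R) setT).

Definition dlaw (R : realType) (f : pdensity R) : probability R R :=
  distribution (dprob f) (@toR R).

Lemma ge0_integral_dlaw (R : realType) (f : pdensity R) (h : R -> \bar R) :
  measurable_fun setT h -> (forall x, 0 <= h x)%E ->
  (\int[dlaw f]_x h x = \int[lebesgue_measure]_x (h x * (f x)%:E))%E.
Proof.
by move=> mh h0; rewrite ge0_integral_distribution// ge0_integral_dprob.
Qed.

Lemma measurable_preimage_addr (R : realType) (A : set R) (y : R) :
  measurable A -> measurable [set x | A (x + y)].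
Proof.
move=> mA; rewrite -[X in measurable X]setTI.
by apply: (_ : measurable_fun setT (fun x : R => x + y)) => //;
  exact: measurable_funD.
Qed.

Section convolution.
Context {R : realType}.
Implicit Types P Q H : probability R R.

Definition addpair (z : R * R) : R := z.1 + z.2.

Let measurable_addpair : measurable_fun setT addpair.
Proof. exact: measurable_funD. Qed.

HB.instance Definition _ :=
  isMeasurableFun.Build _ _ _ _ addpair measurable_addpair.

Definition conv P Q : probability R R := distribution (P \x Q)%E addpair.

Lemma ge0_integral_conv P Q (h : R -> \bar R) : measurable_fun setT h ->
  (forall x, 0 <= h x)%E ->
  (\int[conv P Q]_z h z = \int[P]_x \int[Q]_y h (x + y)%R)%E.
Proof.
move=> mh h0; rewrite ge0_integral_distribution// fubini_tonelli1//.
- exact: measurableT_comp.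
- by move=> z; exact: h0.
Qed.

(** Integrating over the second summand last leaves [P] visible only through its values on sets, the
    form to which a total variation bound on [P] applies pointwise. *)
Lemma convEr P Q A : measurable A ->
  conv P Q A = (\int[Q]_y P [set x | A (x + y)%R])%E.
Proof.
move=> mA.
have m1 : measurable_fun setT (EFin \o \1_A : R -> \bar R).
  exact/measurable_EFinP/measurable_indic.
have m2 : measurable_fun setT (fun z : R * R => (\1_A (z.1 + z.2))%:E : \bar R).
  exact: (measurableT_comp m1 measurable_addpair).
transitivity (\int[conv P Q]_z (\1_A z)%:E)%E;
  first by rewrite integral_indic// setIT.
rewrite ge0_integral_conv//=.
rewrite (fubini_tonelli (fun z : R * R => (\1_A (z.1 + z.2))%:E))//.
apply: eq_integral => y _ /=.
have mAy := measurable_preimage_addr y mA.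
transitivity (\int[P]_x (\1_[set x | A (x + y)%R] x)%:E)%E; last first.
  by rewrite integral_indic// setIT.
by apply: eq_integral => x _; rewrite !indicE; congr (_%:R)%:E; apply/idP/idP;
  rewrite !inE.
Qed.

(** Both sides unfold to triple integrals whose two inner integrals are exchanged by Tonelli. *)
Lemma convAC P Q H A : measurable A ->
  conv (conv P Q) H A = conv (conv P H) Q A.
Proof.
move=> mA.
have m1 : measurable_fun setT (EFin \o \1_A : R -> \bar R).
  exact/measurable_EFinP/measurable_indic.
have E (Q' H' : probability R R) : conv (conv P Q') H' A =
    (\int[P]_x \int[Q']_y \int[H']_z (\1_A (x + y + z)%R)%:E)%E.
  transitivity (\int[conv (conv P Q') H']_z (\1_A z)%:E)%E.
    by rewrite integral_indic// setIT.
  rewrite ge0_integral_conv//=.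
  rewrite ge0_integral_conv//=.
    apply: (measurable_fun_fubini_tonelli_F (fun z : R * R => (\1_A (z.1 + z.2))%:E)).
      exact: (measurableT_comp m1 measurable_addpair).
    by move=> z; rewrite lee_fin.
  by move=> x; apply: integral_ge0 => y _; rewrite lee_fin.
rewrite !E; apply: eq_integral => x _.
rewrite (fubini_tonelli (fun z : R * R => (\1_A (x + z.1 + z.2))%:E))//.
- by apply: eq_integral => y _; apply: eq_integral => z _ /=; rewrite addrAC.
- apply: (measurableT_comp m1); apply: measurable_funD => //.
  exact: measurable_funD.
Qed.

End convolution.

(** Between probability measures, passing to complements yields the reverse inequality, so the
    one-sided form already says that the total variation distance is at most [e]. *)
Definition tvle (R : realType) d (T : measurableType d) (P Q : set T -> \bar R)
    (e : R) :=
  forall A, measurable A -> (P A <= Q A + e%:E)%E.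

Section tvle.
Context {R : realType}.

Lemma tvle_trans d (T : measurableType d) (P Q H : set T -> \bar R) (a b : R) :
  tvle P Q a -> tvle Q H b -> tvle P H (a + b).
Proof.
move=> PQ QH A mA; apply: le_trans (PQ A mA) _.
rewrite (_ : (a + b)%:E = b%:E + a%:E)%E; last by rewrite -EFinD addrC.
by rewrite addeA; apply: leeD2r; exact: QH.
Qed.

Lemma ge0_le_integral_cst_add d (T : measurableType d) (P : probability T R)
    (f g : T -> \bar R) (e : R) : 0 <= e ->
  measurable_fun setT f -> measurable_fun setT g ->
  (forall x, 0 <= f x)%E -> (forall x, 0 <= g x)%E ->
  (forall x, f x <= g x + e%:E)%E ->
  (\int[P]_x f x <= \int[P]_x g x + e%:E)%E.
Proof.
move=> e0 mf mg f0 g0 fg.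
have <- : (\int[P]_x (g x + e%:E) = \int[P]_x g x + e%:E)%E.
  rewrite ge0_integralD//= integral_cst//.
  rewrite -[in RHS](mule1 e%:E); congr (_ + _ * _)%E; exact: probability_setT.
apply: ge0_le_integral => //; exact: emeasurable_funD.
Qed.

Lemma tvle_conv (P Q H : probability R R) (e : R) : 0 <= e ->
  tvle P Q e -> tvle (conv P H) (conv Q H) e.
Proof.
move=> e0 PQ A mA; rewrite !convEr//.
have mAy y := measurable_preimage_addr y mA.
have mB : measurable (@addpair R @^-1` A) by rewrite -[X in measurable X]setTI;
  exact: measurable_funPT.
have mP (P' : probability R R) :
    measurable_fun setT (fun y : R => P' [set x | A (x + y)]).
  rewrite (_ : (fun y => _) = P' \o ysection (@addpair R @^-1` A)).
    exact: measurable_fun_ysection.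
  by apply/funext => y; congr (P' _); apply/seteqP; split=> x /=;
    rewrite /ysection /= inE.
by apply: ge0_le_integral_cst_add => // y; exact: PQ.
Qed.

End tvle.

(** * Product laws and Le Cam's two-point bound *)

Section tuple_prod.
Context {R : realType}.
Implicit Types P Q : probability R R.

Definition tcons n (z : R * n.-tuple R) : n.+1.-tuple R :=
  [the _.-tuple _ of z.1 :: z.2].

Let measurable_tcons n : measurable_fun setT (@tcons n).
Proof. exact: (measurable_cons measurable_fst measurable_snd). Qed.

HB.instance Definition _ n :=
  isMeasurableFun.Build _ _ _ _ (@tcons n) (@measurable_tcons n).

Fixpoint tprod P n : probability (n.-tuple R) R :=
  match n with
  | 0 => \d_ [tuple]
  | m.+1 => distribution (P \x tprod P m)%E (@tcons m)
  end.

Lemma tprodS P n A : tprod P n.+1 A = (P \x tprod P n)%E (@tcons n @^-1` A).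
Proof. by []. Qed.

Lemma measurable_box n (A : 'I_n -> set R) : (forall i, measurable (A i)) ->
  measurable [set w : n.-tuple R | forall i, A i (tnth w i)].
Proof.
move=> mA; rewrite (_ : mkset _ =
    \bigcap_(i in [set: 'I_n]) ((@tnth n R)^~ i @^-1` A i)); last first.
  by apply/seteqP; split=> w /= H i => [_|]; exact: H.
apply: fin_bigcap_measurable => // i _.
by rewrite -[X in measurable X]setTI; exact: measurable_tnth.
Qed.

Lemma tprod_box P n (A : 'I_n -> set R) : (forall i, measurable (A i)) ->
  tprod P n [set w | forall i, A i (tnth w i)] = (\prod_i P (A i))%E.
Proof.
elim: n A => [A mA|n IH A mA].
  by rewrite big_ord0 /= diracE mem_set// => -[].
rewrite big_ord_recl tprodS -IH; last by move=> i; exact: mA.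
rewrite -product_measure1E//; last first.
  by apply: (@measurable_box n (fun i => A (lift ord0 i))) => i; exact: mA.
congr ((P \x tprod P n)%E _); apply/seteqP; split=> -[x w] /=.
  move=> H; split; first by have := H ord0.
  by move=> i; have := H (lift ord0 i); rewrite tnthS.
move=> [H0 H] i; case: (unliftP ord0 i) => [j ->|->]//.
by rewrite tnthS.
Qed.

Lemma tprod_marginal P n (i : 'I_n) (A : set R) : measurable A ->
  tprod P n ((@tnth n R)^~ i @^-1` A) = P A.
Proof.
(* The event is a box whose other sides are [setT], each contributing a factor 1. *)
move=> mA; pose B j := if j == i then A else setT.
rewrite (_ : _ @^-1` _ = [set w | forall j, B j (tnth w j)]); last first.
  apply/seteqP; split=> w /=; last by move/(_ i); rewrite /B eqxx.
  by move=> Aw j; rewrite /B; case: eqP => // ->.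
rewrite tprod_box; last by move=> j; rewrite /B; case: ifP.
rewrite (bigD1 i)//= {1}/B eqxx big1 ?mule1// => j /negbTE ji.
by rewrite /B ji probability_setT.
Qed.

Lemma tprod_independent P n (J : {set 'I_n}) (A : 'I_n -> set R) :
  (forall i, measurable (A i)) ->
  tprod P n [set w | forall i, i \in J -> A i (tnth w i)] =
  (\prod_(i in J) tprod P n ((@tnth n R)^~ i @^-1` A i))%E.
Proof.
move=> mA; pose B i := if i \in J then A i else setT.
rewrite (_ : mkset _ = [set w | forall j, B j (tnth w j)]); last first.
  apply/seteqP; split=> w /= H i; first by rewrite /B; case: ifP => // /H.
  by move=> iJ; have := H i; rewrite /B iJ.
rewrite tprod_box; last by move=> j; rewrite /B; case: ifP.
rewrite [RHS]big_mkcond/=; apply: eq_bigr => i _; rewrite /B.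
by case: ifP => _; rewrite ?probability_setT// tprod_marginal.
Qed.

(** Hybrid argument through [P1 \x Q2]: the second factor is exchanged by slicing along the first
    coordinate, then the first factor by slicing along the second. *)
Lemma tvle_prod d1 d2 (T1 : measurableType d1) (T2 : measurableType d2)
    (P1 Q1 : probability T1 R) (P2 Q2 : probability T2 R) (a b : R) :
  0 <= a -> 0 <= b -> tvle P1 Q1 a -> tvle P2 Q2 b ->
  tvle (P1 \x P2)%E (Q1 \x Q2)%E (b + a).
Proof.
move=> a0 b0 PQ1 PQ2; apply: (@tvle_trans _ _ _ _ (P1 \x Q2)%E).
  move=> A mA; apply: ge0_le_integral_cst_add => //.
  - exact: measurable_fun_xsection.
  - exact: measurable_fun_xsection.
  - by move=> x; exact/PQ2/measurable_xsection.
move=> A mA.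
have E (P : probability T1 R) : (P \x Q2)%E A = (\int[Q2]_y P (ysection A y))%E.
  rewrite (product_measure_unique (m' := (P \x^ Q2)%E))// => B C mB mC.
  exact: product_measure2E.
rewrite !E; apply: ge0_le_integral_cst_add => //.
- exact: measurable_fun_ysection.
- exact: measurable_fun_ysection.
- by move=> x; exact/PQ1/measurable_ysection.
Qed.

Lemma tvle_tprod P Q n (e : R) : 0 <= e -> tvle P Q e ->
  tvle (tprod P n) (tprod Q n) (n%:R * e).
Proof.
move=> e0 PQ; elim: n => [A mA|n IH A mA]; first by rewrite mul0r adde0.
rewrite !tprodS -natr1 mulrDl mul1r; apply: tvle_prod => //.
  by rewrite mulr_ge0.
by rewrite -[X in measurable X]setTI; exact: measurable_funPT.
Qed.

End tuple_prod.

Lemma le_cam d (T : measurableType d) (R : realType) (P Q : probability T R)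
    (u v : T -> \bar R) (D e : R) : 0 <= D -> tvle Q P e ->
  measurable_fun setT u -> measurable_fun setT v ->
  (forall w, 0 <= u w)%E -> (forall w, 0 <= v w)%E ->
  (forall w, D%:E <= u w + v w)%E ->
  (((1 - e) * (D / 2))%:E <= \int[P]_w u w + \int[Q]_w v w)%E.
Proof.
move=> D0 QP um vm u0 v0 uv.
pose A := [set w | ((D / 2)%:E <= u w)%E].
have mA : measurable A.
  by rewrite -[A]setTI; exact: emeasurable_fun_c_infty.
have D2 : 0 <= D / 2 by rewrite divr_ge0.
have lb (S : probability T R) (f : T -> \bar R) (B : set T) : measurable B ->
    measurable_fun setT f -> (forall w, 0 <= f w)%E ->
    (forall w, B w -> ((D / 2)%:E <= f w)%E) ->
    ((D / 2)%:E * S B <= \int[S]_w f w)%E.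
  move=> mB mf f0 Bf; rewrite -integral_cst//.
  apply: (@le_trans _ _ (\int[S]_(w in B) f w)%E).
    by apply: ge0_le_integral => //; exact: measurable_funTS.
  by apply: ge0_subset_integral.
have Pu := lb P u A mA um u0 (fun w Aw => Aw).
have Qv : ((D / 2)%:E * Q (~` A) <= \int[Q]_w v w)%E.
  apply: lb => //; first exact: measurableC.
  move=> w /= /negP; rewrite -ltNge => uw.
  have := uv w; rewrite leNgt => /negP; apply: contra_notP => /negP.
  rewrite -ltNge => vw.
  have -> : (D%:E = (D / 2)%:E + (D / 2)%:E)%E by rewrite -EFinD -splitr.
  exact: lteD.
apply: le_trans (leeD Pu Qv).
have PA : P A = (fine (P A))%:E by rewrite fineK// fin_num_measure.
have QA : Q A = (fine (Q A))%:E by rewrite fineK// fin_num_measure.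
have := QP A mA; rewrite probability_setC// PA QA.
rewrite -EFinB -!EFinM -!EFinD !lee_fin => h.
by have := ler_wpM2l D2 h; lra.
Qed.

(** * Compound Poisson laws *)

Lemma bounded_integrable d (T : measurableType d) (R : realType)
    (P : probability T R) (h : T -> R) (M : R) :
  measurable_fun setT h -> (forall x, `|h x| <= M) ->
  P.-integrable setT (EFin \o h).
Proof.
move=> mh hM; apply: (@le_integrable _ _ _ P setT measurableT _ (cst M%:E)).
- exact/measurable_EFinP.
- by move=> x _ /=; rewrite lee_fin (le_trans (hM x)) ?ler_norm.
- exact: finite_measure_integrable_cst.
Qed.

(** Adding [M] makes [h] nonnegative. The integral formulas for laws with a density and for
    mixtures, proved for nonnegative functions, thereby extend to sines and cosines. *)
Lemma integral_bounded_addr d (T : measurableType d) (R : realType)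
    (P : probability T R) (h : T -> R) (M : R) :
  measurable_fun setT h -> (forall x, `|h x| <= M) ->
  (\int[P]_x (h x + M)%:E = (\int[P]_x h x + M)%:E)%E.
Proof.
move=> mh hM; have hi := bounded_integrable P mh hM.
under eq_integral do rewrite EFinD.
rewrite integralD//; last exact: (@bounded_integrable _ _ _ P (cst M) `|M|).
rewrite integral_cst// [X in (_ * X)%E](probability_setT P) mule1 EFinD.
by rewrite /Rintegral fineK//; apply: integrable_fin_num => //; exact: hi.
Qed.

Section convolution_powers.
Context {R : realType}.
Implicit Types G F P Q : probability R R.

Fixpoint convpow G F k : probability R R :=
  if k is j.+1 then conv (convpow G F j) F else G.

Lemma convpowS G F k : convpow G F k.+1 = conv (convpow G F k) F.
Proof. by []. Qed.

(* Factors are exchanged one at a time; [convAC] brings the factor being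
   exchanged next to [G], which smooths it. *)
Lemma tvle_convpow G F1 F2 (e : R) k : 0 <= e ->
  tvle (conv G F1) (conv G F2) e ->
  tvle (convpow G F1 k) (convpow G F2 k) (k%:R * e).
Proof.
move=> e0 h; elim: k => [A mA|k IH]; first by rewrite mul0r adde0.
have hk j : tvle (conv (convpow G F2 j) F1) (conv (convpow G F2 j) F2) e.
  elim: j => [//|j IHj] A mA; rewrite convpowS convAC//.
  exact: tvle_conv.
rewrite !convpowS -natr1 mulrDl mul1r; apply: (tvle_trans _ (hk k)).
by apply: tvle_conv => //; rewrite mulr_ge0.
Qed.

Lemma Rintegral_conv P Q (h : R -> R) (M : R) : measurable_fun setT h ->
  (forall x, `|h x| <= M) ->
  \int[conv P Q]_z h z = \int[P]_x \int[Q]_y h (x + y).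
Proof.
move=> mh hM.
have mhD : measurable_fun setT (h \o @addpair R) by exact: measurableT_comp.
have hi : (P \x Q)%E.-integrable setT (EFin \o (h \o @addpair R)).
  by apply: (@bounded_integrable _ _ _ (P \x Q)%E _ M) => //= x; exact: hM.
rewrite {1}/Rintegral.
rewrite (@integral_distribution _ _ _ _ _ (P \x Q)%E (@addpair R))//;
  last first.
  exact/measurable_EFinP.
rewrite -integral12_prod_meas1//; congr fine; apply: eq_integral => x _.
rewrite /fubini_F /Rintegral fineK//; apply: integrable_fin_num => //.
apply: (@bounded_integrable _ _ _ Q _ M) => //=.
by apply: (measurableT_comp mh); exact: measurable_funD.
Qed.

(** The sine integral is part of the predicate because the addition formula for the cosine produces
    a product of sines, which must vanish for the cosine integrals to multiply under convolution. *)
Definition real_cf P (phi : R -> R) := forall t,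
  \int[P]_x cos (t * x) = phi t /\ \int[P]_x sin (t * x) = 0.

Lemma real_cf_conv P Q phi psi : real_cf P phi -> real_cf Q psi ->
  real_cf (conv P Q) (fun t => phi t * psi t).
Proof.
move=> hP hQ t.
have [P1 P2] := hP t; have [Q1 Q2] := hQ t.
have icos (S : probability R R) : S.-integrable setT (EFin \o (fun x => cos (t * x))).
  apply: (@bounded_integrable _ _ _ _ _ 1); first exact: measurable_cosM.
  by move=> x; exact: cos_max.
have isin (S : probability R R) : S.-integrable setT (EFin \o (fun x => sin (t * x))).
  apply: (@bounded_integrable _ _ _ _ _ 1); first exact: measurable_sinM.
  by move=> x; exact: sin_max.
split.
- rewrite (@Rintegral_conv _ _ _ 1); [|exact: measurable_cosM|
    by move=> x; exact: cos_max].
  transitivity (\int[P]_x (psi t * cos (t * x))).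
    apply: eq_Rintegral => x _.
    transitivity (\int[Q]_y (cos (t * x) * cos (t * y) - sin (t * x) * sin (t * y))).
      by apply: eq_Rintegral => y _; rewrite mulrDr cosD.
    rewrite RintegralB//; [|exact: (integrable_EFinZ measurableT _ (icos Q))|
      exact: (integrable_EFinZ measurableT _ (isin Q))].
    rewrite (RintegralZl _ measurableT (icos Q)).
    by rewrite (RintegralZl _ measurableT (isin Q)) Q1 Q2; ring.
  by rewrite (RintegralZl _ measurableT (icos P)) P1 mulrC.
- rewrite (@Rintegral_conv _ _ _ 1); [|exact: measurable_sinM|
    by move=> x; exact: sin_max].
  transitivity (\int[P]_x (psi t * sin (t * x))).
    apply: eq_Rintegral => x _.
    transitivity (\int[Q]_y (sin (t * x) * cos (t * y) + cos (t * x) * sin (t * y))).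
      by apply: eq_Rintegral => y _; rewrite mulrDr sinD.
    rewrite RintegralD//; [|exact: (integrable_EFinZ measurableT _ (icos Q))|
      exact: (integrable_EFinZ measurableT _ (isin Q))].
    rewrite (RintegralZl _ measurableT (icos Q)).
    by rewrite (RintegralZl _ measurableT (isin Q)) Q1 Q2; ring.
  by rewrite (RintegralZl _ measurableT (isin P)) P2 mulr0.
Qed.

Lemma real_cf_convpow G F phi psi k : real_cf G phi -> real_cf F psi ->
  real_cf (convpow G F k) (fun t => phi t * psi t ^+ k).
Proof.
move=> hG hF; elim: k => [|k IH] t /=.
  by rewrite expr0 mulr1; exact: hG.
by rewrite exprSr mulrA; exact: (real_cf_conv IH hF).
Qed.

End convolution_powers.

(** * Poisson mixtures *)

Lemma cvg_seriesM (R : realType) (u : R^nat) (c l : R) : series u @ \oo --> l ->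
  series (fun k => c * u k) @ \oo --> c * l.
Proof.
move=> ul; rewrite (_ : series _ = (fun n => c * series u n)); last first.
  by apply/funext => n; rewrite /series/= mulr_sumr.
by apply: cvgM => //; exact: cvg_cst.
Qed.

Lemma nneseries_EFin (R : realType) (u : R^nat) (l : R) : series u @ \oo --> l ->
  (\sum_(k <oo) (u k)%:E = l%:E)%E.
Proof.
move=> ul; apply/cvg_lim => //.
rewrite (_ : (fun n => _) = EFin \o series u); last first.
  by apply/funext => n; rewrite /= /series/= sumEFin.
by apply: cvg_EFin => //; exact: nearW.
Qed.

Section poisson_series.
Context {R : realType}.
Variables (lam : R) (lam0 : 0 < lam).

(** The Poisson generating function. It serves at [y = 1] for the total mass, at [y = 2] for the
    total variation bound and at [y = psi t] for the characteristic function of the mixture. *)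
Lemma cvg_poisson_series (y : R) :
  series (fun k => poisson_pmf lam k * y ^+ k) @ \oo --> expR (lam * (y - 1)).
Proof.
rewrite (_ : series _ =
  (fun n => expR (- lam) * series (exp_coeff (lam * y)) n)); last first.
  apply/funext => n; rewrite /series/= mulr_sumr; apply: eq_bigr => k _.
  by rewrite /poisson_pmf lam0 /exp_coeff /= exprMn; ring.
rewrite (_ : lam * (y - 1) = - lam + lam * y); last by ring.
rewrite expRD; apply: cvgM; first exact: cvg_cst.
exact: is_cvg_series_exp_coeff.
Qed.

Lemma cvg_poisson_pmf : series (poisson_pmf lam) @ \oo --> (1 : R).
Proof.
have := @cvg_poisson_series 1; rewrite subrr mulr0 expR0.
by under [X in series X]eq_fun do rewrite expr1n mulr1.
Qed.

End poisson_series.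

Definition poisson_mix (R : realType) (lam : R) (lam0 : 0 < lam)
    (B : nat -> probability R R) : set _ -> \bar R :=
  mseries (fun k => mscale (NngNum (poisson_pmf_ge0 lam k)) (B k)) 0.

Section poisson_mix.
Context {R : realType}.
Variables (lam : R) (lam0 : 0 < lam).
Implicit Types B : nat -> probability R R.

HB.instance Definition _ B := Measure.on (poisson_mix lam0 B).

Lemma poisson_mixE B A :
  poisson_mix lam0 B A = (\sum_(k <oo) (poisson_pmf lam k)%:E * B k A)%E.
Proof. by []. Qed.

Lemma ge0_integral_poisson_mix B (h : R -> \bar R) : measurable_fun setT h ->
  (forall x, 0 <= h x)%E ->
  (\int[poisson_mix lam0 B]_x h x =
   \sum_(k <oo) (poisson_pmf lam k)%:E * \int[B k]_x h x)%E.
Proof.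
move=> mh h0; rewrite ge0_integral_measure_series//.
by apply: eq_eseriesr => k _; rewrite ge0_integral_mscale.
Qed.

Let poisson_mix_setT B : poisson_mix lam0 B setT = 1%E.
Proof.
rewrite poisson_mixE.
under eq_eseriesr do rewrite probability_setT mule1.
apply: nneseries_EFin.
exact: cvg_poisson_pmf.
Qed.

HB.instance Definition _ B :=
  @Measure_isProbability.Build _ _ R (poisson_mix lam0 B) (poisson_mix_setT B).

Lemma Rintegral_poisson_mix B (h : R -> R) (M l : R) : measurable_fun setT h ->
  (forall x, `|h x| <= M) ->
  series (fun k => poisson_pmf lam k * \int[B k]_x h x) @ \oo --> l ->
  \int[poisson_mix lam0 B]_x h x = l.
Proof.
move=> mh hM hl.
have h0 x : (0 <= (h x + M)%:E)%E.
  by rewrite lee_fin -lerBlDr sub0r; have /ler_normlP[] := hM x; lra.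
have mhM : measurable_fun setT (fun x => (h x + M)%:E).
  by apply/measurable_EFinP; exact: measurable_funD.
have := ge0_integral_poisson_mix B mhM h0.
rewrite (integral_bounded_addr (poisson_mix lam0 B) mh hM).
under eq_eseriesr do rewrite (integral_bounded_addr (B _) mh hM) -EFinM
  mulrDr [_ * M]mulrC.
rewrite (@nneseries_EFin _ _ (l + M * 1)).
  by move=> []; rewrite mulr1; exact: addIr.
rewrite (_ : series _ = (series (fun k => poisson_pmf lam k * \int[B k]_x h x) \+
    series (fun k => M * poisson_pmf lam k))); last first.
  by apply/funext => n; rewrite /series/= big_split.
by apply: cvgD => //; apply: cvg_seriesM; exact: cvg_poisson_pmf.
Qed.

(* The factor [expR lam] comes from [k <= 2 ^ k], which avoids computing the
   mean of the Poisson law. *)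
Lemma tvle_poisson_mix B1 B2 (e : R) : 0 <= e ->
  (forall k, tvle (B1 k) (B2 k) (k%:R * e)) ->
  tvle (poisson_mix lam0 B1) (poisson_mix lam0 B2) (expR lam * e).
Proof.
move=> e0 B12 A mA; rewrite !poisson_mixE.
have c2 : (\sum_(k <oo) (e * (poisson_pmf lam k * 2 ^+ k))%:E = (expR lam * e)%:E)%E.
  apply: nneseries_EFin; rewrite [expR _ * _]mulrC; apply: cvg_seriesM.
  by have := @cvg_poisson_series _ _ lam0 2;
    rewrite (_ : lam * (2 - 1) = lam)//; ring.
rewrite -c2 -nneseriesD//; last 2 first.
- by move=> k _ _; rewrite mule_ge0// lee_fin poisson_pmf_ge0.
- by move=> k _ _; rewrite lee_fin !mulr_ge0// ?poisson_pmf_ge0// exprn_ge0.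
apply: lee_nneseries => [k _ _|k _].
  by rewrite mule_ge0// lee_fin poisson_pmf_ge0.
apply: (@le_trans _ _ ((poisson_pmf lam k)%:E * (B2 k A + (k%:R * e)%:E))%E).
  by rewrite lee_wpmul2l ?lee_fin ?poisson_pmf_ge0//; exact: B12.
rewrite ge0_muleDr//; last by rewrite lee_fin mulr_ge0.
rewrite leeD2l// -EFinM lee_fin.
rewrite [e * _](_ : _ = poisson_pmf lam k * (2 ^+ k * e)); last by ring.
rewrite ler_wpM2l ?poisson_pmf_ge0// ler_wpM2r//.
by rewrite -natrX ler_nat; exact/ltnW/ltn_expl.
Qed.

Lemma real_cf_poisson_mix B phi psi :
  (forall k, real_cf (B k) (fun t => phi t * psi t ^+ k)) ->
  real_cf (poisson_mix lam0 B) (fun t => phi t * expR (lam * (psi t - 1))).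
Proof.
move=> hB t; split.
- apply: (@Rintegral_poisson_mix _ _ 1); first exact: measurable_cosM.
    by move=> x; exact: cos_max.
  under [X in series X]eq_fun do rewrite (hB _ t).1 mulrCA.
  by apply: cvg_seriesM; exact: cvg_poisson_series.
- apply: (@Rintegral_poisson_mix _ _ 1); first exact: measurable_sinM.
    by move=> x; exact: sin_max.
  under [X in series X]eq_fun do rewrite (hB _ t).2 mulr0.
  rewrite (_ : series _ = cst 0); first exact: cvg_cst.
  by apply/funext => n; rewrite /series/= big1.
Qed.

End poisson_mix.

Section dlaw_theory.
Context {R : realType}.
Local Notation mu := (@lebesgue_measure R).

Lemma integrable_densM (f : pdensity R) (h : R -> R) (M : R) :
  measurable_fun setT h -> (forall x, `|h x| <= M) ->
  mu.-integrable setT (EFin \o (fun x => f x * h x)).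
Proof.
move=> mh hM; apply: (@le_integrable _ _ _ mu setT measurableT _
    (EFin \o (fun x => M * f x))).
- by apply/measurable_EFinP/measurable_funM => //; exact: measurable_dens.
- move=> x _ /=; rewrite lee_fin !normrM mulrC ler_wpM2r//.
  by rewrite (le_trans (hM x))// ler_norm.
- by apply: integrable_EFinZ => //; exact: integrable_dens.
Qed.

Lemma Rintegral_dlaw (f : pdensity R) (h : R -> R) (M : R) :
  measurable_fun setT h -> (forall x, `|h x| <= M) ->
  \int[dlaw f]_x h x = \int[mu]_x (f x * h x).
Proof.
move=> mh hM.
have fhi := integrable_densM f mh hM.
have h0 x : (0 <= (h x + M)%:E)%E.
  by rewrite lee_fin -lerBlDr sub0r; have /ler_normlP[] := hM x; lra.
have mhM : measurable_fun setT (fun x => (h x + M)%:E).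
  by apply/measurable_EFinP; exact: measurable_funD.
have := ge0_integral_dlaw f mhM h0.
rewrite (integral_bounded_addr (dlaw f) mh hM).
have -> : (\int[mu]_x ((h x + M)%:E * (f x)%:E) = (\int[mu]_x (f x * h x) + M)%:E)%E.
  transitivity (\int[mu]_x ((f x * h x)%:E + (M * f x)%:E))%E.
    by apply: eq_integral => x _; rewrite -EFinM -EFinD; congr EFin; ring.
  rewrite integralD//; last by apply: integrable_EFinZ => //; exact: integrable_dens.
  rewrite EFinD; congr (_ + _)%E.
    by rewrite /Rintegral fineK//; apply: integrable_fin_num => //; exact: fhi.
  under eq_integral do rewrite EFinM.
  by rewrite integralZl ?integral_dens ?mule1//; exact: integrable_dens.
by move=> []; exact: addIr.
Qed.

Lemma conv_dlaw (f g : pdensity R) (A : set R) : measurable A ->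
  (conv (dlaw f) (dlaw g) A =
   \int[mu]_z ((\1_A z)%:E * \int[mu]_y (f (z - y) * g y)%:E))%E.
Proof.
move=> mA.
have m1 : measurable_fun setT (\1_A : R -> R) by exact: measurable_indic.
have mf := measurable_dens f; have mg := measurable_dens g.
have mAy y := measurable_preimage_addr y mA.
have dA y : (dlaw f [set x | A (x + y)%R] = \int[mu]_z ((\1_A z * f (z - y))%:E))%E.
  transitivity (\int[dlaw f]_x (\1_[set x | A (x + y)%R] x)%:E)%E.
    by rewrite integral_indic// setIT.
  rewrite ge0_integral_dlaw//; last first.
    by apply/measurable_EFinP; exact: measurable_indic.
  rewrite -[RHS](@integral_shift _ y); last first.
    apply/measurable_EFinP; apply: measurable_funM => //.
    by apply: (measurableT_comp mf); exact: measurable_funD.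
  apply: eq_integral => x _; rewrite -EFinM addrK !indicE.
  by congr (_%:R * _)%:E; apply/idP/idP; rewrite !inE.
rewrite convEr//.
under eq_integral do rewrite dA.
rewrite ge0_integral_dlaw//; last 2 first.
- apply: (measurable_fun_fubini_tonelli_G (m1 := mu)
    (fun z : R * R => (\1_A z.1 * f (z.1 - z.2))%:E)) => [|z].
    apply/measurable_EFinP; apply: measurable_funM; first exact: measurableT_comp.
    by apply: (measurableT_comp mf); exact: measurable_funB.
  by rewrite lee_fin mulr_ge0// dens_ge0.
- by move=> y; apply: integral_ge0 => z _; rewrite lee_fin mulr_ge0// dens_ge0.
transitivity (\int[mu]_y \int[mu]_z (\1_A z * f (z - y) * g y)%:E)%E.
  apply: eq_integral => y _; rewrite -ge0_integralZr//.
  - apply/measurable_EFinP; apply: measurable_funM => //.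
    by apply: (measurableT_comp mf); exact: measurable_funD.
  - by move=> z _; rewrite lee_fin mulr_ge0// dens_ge0.
  - by rewrite lee_fin dens_ge0.
rewrite -(fubini_tonelli (m1 := mu) (m2 := mu)
  (fun z : R * R => (\1_A z.1 * f (z.1 - z.2) * g z.2)%:E)); last 2 first.
- apply/measurable_EFinP; apply: measurable_funM; last exact: measurableT_comp.
  apply: measurable_funM; first exact: measurableT_comp.
  by apply: (measurableT_comp mf); exact: measurable_funB.
- by move=> z; rewrite lee_fin !mulr_ge0// dens_ge0.
apply: eq_integral => z _ /=; rewrite -ge0_integralZl//.
- by apply: eq_integral => y _; rewrite -EFinM mulrA.
- apply/measurable_EFinP; apply: measurable_funM => //.
  by apply: (measurableT_comp mf); exact: measurable_funB.
- by move=> y _; rewrite lee_fin mulr_ge0// dens_ge0.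
Qed.

End dlaw_theory.

(** * Oscillating perturbations of a Gaussian density *)

Section gaussian_conv.
Context {R : realType}.
Local Notation mu := (@lebesgue_measure R).
Implicit Types (s t x y z m a : R).

(* Completing the square: the left-hand side is the joint density of the sum
   and of one term of two independent centred Gaussian variables. *)
Lemma normal_pdf_mul s t y z : 0 < s -> 0 < t ->
  let u := Num.sqrt (s ^+ 2 + t ^+ 2) in
  normal_pdf 0 s (z - y) * normal_pdf 0 t y =
  normal_pdf 0 u z * normal_pdf (t ^+ 2 / u ^+ 2 * z) (s * t / u) y.
Proof.
move=> s0 t0 /=.
set u := Num.sqrt _.
have u2 : u ^+ 2 = s ^+ 2 + t ^+ 2 by rewrite sqr_sqrtr// addr_ge0 ?sqr_ge0.
have st0 : 0 < s ^+ 2 + t ^+ 2 by rewrite addr_gt0// exprn_gt0.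
have u0 : 0 < u by rewrite sqrtr_gt0.
have r0 : 0 < s * t / u by rewrite divr_gt0// mulr_gt0.
rewrite !normal_pdfE ?gt_eqF// mulrACA [RHS]mulrACA; congr (_ * _).
  have p0 w : 0 <= w ^+ 2 * pi *+ 2 :> R.
    by rewrite mulrn_wge0//; apply: mulr_ge0; rewrite ?sqr_ge0 ?pi_ge0.
  rewrite /normal_peak -!invfM -!sqrtrM//.
  by congr (Num.sqrt _)^-1; field; rewrite gt_eqF.
rewrite /normal_fun -!expRD; congr expR.
rewrite !expr_div_n !exprMn u2; field.
by rewrite !gt_eqF.
Qed.

(* The exponential is the mean of [cos (m * x)] under the Gaussian density, so
   that the total mass is 1. *)
Definition wave t m a x : R :=
  normal_pdf 0 t x * (1 + a * (cos (m * x) - expR (- (t ^+ 2 * m ^+ 2 / 2)))).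

Lemma measurable_wave t m a : measurable_fun setT (wave t m a).
Proof.
apply: measurable_funM; first exact: measurable_normal_pdf.
apply: measurable_funD => //; apply: measurable_funM => //.
by apply: measurable_funB => //; exact: measurable_cosM.
Qed.

Lemma expRN_le1 x : 0 <= x -> expR (- x) <= 1.
Proof. by move=> x0; rewrite -expR0 ler_expR oppr_le0. Qed.

(** The threshold 1/2 comes from positivity: the cosine minus its mean [e] has absolute value at
    most 2. *)
Lemma wave_factor_bound t m a x : `|a| <= 2^-1 ->
  0 <= 1 + a * (cos (m * x) - expR (- (t ^+ 2 * m ^+ 2 / 2))) <= 2.
Proof.
move=> a1; set e := expR _.
have e1 : 0 <= e <= 1.
  by rewrite expR_ge0 expRN_le1// divr_ge0// mulr_ge0 ?sqr_ge0.
have c1 := cos_max (m * x).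
suff : `|a * (cos (m * x) - e)| <= 1 by rewrite ler_norml; lra.
rewrite normrM (le_trans (ler_pM (normr_ge0 _) (normr_ge0 _) a1 (_ : _ <= 2)))//.
  by move: c1; rewrite !ler_norml; lra.
by lra.
Qed.

Lemma wave_ge0 t m a : `|a| <= 2^-1 -> forall x, 0 <= wave t m a x.
Proof.
move=> a1 x; rewrite mulr_ge0 ?normal_pdf_ge0//.
by have /andP[] := wave_factor_bound t m x a1.
Qed.

(** Modulation by [cos (m * x)] replaces the Gaussian transform by the half-sum of its translates
    centred at [m] and [- m]; the first term collects the unmodulated part. *)
Definition wave_cf t m a u :=
  (1 - a * expR (- (t ^+ 2 * m ^+ 2 / 2))) * expR (- (t ^+ 2 * u ^+ 2 / 2)) +
  a / 2 * (expR (- (t ^+ 2 * (u - m) ^+ 2 / 2)) +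
           expR (- (t ^+ 2 * (u + m) ^+ 2 / 2))).

Lemma Rintegral_wave_cos t m a u : t != 0 ->
  \int[mu]_x (wave t m a x * cos (u * x)) = wave_cf t m a u.
Proof.
move=> t0; set e := expR (- (t ^+ 2 * m ^+ 2 / 2)).
transitivity (\int[mu]_x ((1 - a * e) * (normal_pdf 0 t x * cos (u * x)) +
   a / 2 * (normal_pdf 0 t x * cos ((u - m) * x) +
            normal_pdf 0 t x * cos ((u + m) * x)))).
  apply: eq_Rintegral => x _; rewrite /wave -/e.
  by rewrite [(u - m) * x]mulrBl [(u + m) * x]mulrDl cosB cosD; field.
have ci v := integrable_normal_cos 0 t v.
have ci2 := integrable_EFinD measurableT (ci (u - m)) (ci (u + m)).
rewrite RintegralD//; [|exact: (integrable_EFinZ measurableT _ (ci _))|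
  exact: (integrable_EFinZ measurableT _ ci2)].
rewrite (RintegralZl _ measurableT (ci _)) (RintegralZl _ measurableT ci2).
rewrite (RintegralD measurableT (ci _) (ci _)) !Rintegral_normal_cos//.
by rewrite !mulr0 cos0 !mul1r.
Qed.

Lemma Rintegral_wave_sin t m a u : t != 0 -> `|a| <= 2^-1 ->
  \int[mu]_x (wave t m a x * sin (u * x)) = 0.
Proof.
move=> t0 a1; apply: Rintegral_odd.
- by apply: measurable_funM; [exact: measurable_wave|exact: measurable_sinM].
- rewrite (_ : _ \o _ = EFin \o (fun x => normal_pdf 0 t x *
    ((1 + a * (cos (m * x) - expR (- (t ^+ 2 * m ^+ 2 / 2)))) * sin (u * x))));
      last first.
    by apply/funext => x /=; congr EFin; rewrite /wave [RHS]mulrA.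
  apply: (@integrable_normal_pdfM _ _ _ _ 2).
    apply: measurable_funM; last exact: measurable_sinM.
    apply: measurable_funD => //; apply: measurable_funM => //.
    by apply: measurable_funB => //; exact: measurable_cosM.
  move=> x; rewrite normrM -[leRHS]mulr1 ler_pM ?sin_max//.
  by have /andP[h0 h2] := wave_factor_bound t m x a1; rewrite ger0_norm.
- by move=> x; rewrite /wave normal_pdfN// !mulrN cosN sinN mulrN.
Qed.

Lemma integral_wave t m a : t != 0 -> `|a| <= 2^-1 ->
  (\int[mu]_x (wave t m a x)%:E = 1)%E.
Proof.
move=> t0 a1.
(* The mass is the transform at frequency 0, where both translates equal the centring constant and
   cancel it. *)
have := Rintegral_wave_cos m a 0 t0.
under eq_Rintegral do rewrite mul0r cos0 mulr1.
rewrite /wave_cf expr0n/= mulr0 mul0r oppr0 expR0 sub0r sqrrN add0r mulr1.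
rewrite (_ : _ + _ = 1); last by field.
rewrite /Rintegral => h; rewrite -[LHS]fineK ?h//.
apply: integrable_fin_num => //.
rewrite (_ : (fun x => _) = EFin \o (fun x => normal_pdf 0 t x *
    (1 + a * (cos (m * x) - expR (- (t ^+ 2 * m ^+ 2 / 2))))))//.
apply: (@integrable_normal_pdfM _ _ _ _ 2).
  apply: measurable_funD => //; apply: measurable_funM => //.
  by apply: measurable_funB => //; exact: measurable_cosM.
by move=> x; have /andP[h0 h2] := wave_factor_bound t m x a1; rewrite ger0_norm.
Qed.

Definition wave_density t m a (t0 : t != 0) (a1 : `|a| <= 2^-1) : pdensity R :=
  PDensity (wave_ge0 t m a1) (measurable_wave t m a) (integral_wave m t0 a1).

Definition normal_density s : pdensity R :=
  PDensity (normal_pdf_ge0 0 s) (measurable_normal_pdf 0 s) (integral_normal_pdf 0 s).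

Lemma real_cf_normal s : s != 0 ->
  real_cf (dlaw (normal_density s)) (fun t => expR (- (s ^+ 2 * t ^+ 2 / 2))).
Proof.
move=> s0 t; split.
- rewrite (@Rintegral_dlaw _ _ _ 1); [|exact: measurable_cosM|
    by move=> x; exact: cos_max].
  by rewrite Rintegral_normal_cos// mulr0 cos0 mul1r.
- rewrite (@Rintegral_dlaw _ _ _ 1); [|exact: measurable_sinM|
    by move=> x; exact: sin_max].
  by rewrite Rintegral_normal_sin.
Qed.

Lemma real_cf_wave t m a (t0 : t != 0) (a1 : `|a| <= 2^-1) :
  real_cf (dlaw (wave_density m t0 a1)) (wave_cf t m a).
Proof.
move=> u; split.
- rewrite (@Rintegral_dlaw _ _ _ 1); [|exact: measurable_cosM|
    by move=> x; exact: cos_max].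
  exact: Rintegral_wave_cos.
- rewrite (@Rintegral_dlaw _ _ _ 1); [|exact: measurable_sinM|
    by move=> x; exact: sin_max].
  exact: Rintegral_wave_sin.
Qed.

End gaussian_conv.

(** * Total variation between smoothed waves *)

Section wave_tv.
Context {R : realType}.
Local Notation mu := (@lebesgue_measure R).
Implicit Types (s t x y z m a b c : R).

Lemma integral_normal_wave c s m a e : s != 0 ->
  (\int[mu]_x (normal_pdf c s x * (1 + a * (cos (m * x) - e)))%:E =
   (1 + a * (cos (m * c) * expR (- (s ^+ 2 * m ^+ 2 / 2)) - e))%:E)%E.
Proof.
move=> s0.
have i0 : mu.-integrable setT (EFin \o normal_pdf c s)
  by exact: integrable_normal_pdf.
have i1 := integrable_EFinZ measurableT (1 - a * e) i0.
have i2 := integrable_EFinZ measurableT a (integrable_normal_cos c s m).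
have i3 := integrable_EFinD measurableT i1 i2.
transitivity (\int[mu]_x ((1 - a * e) * normal_pdf c s x +
    a * (normal_pdf c s x * cos (m * x)))%:E)%E.
  by apply: eq_integral => x _; congr EFin; ring.
rewrite EFin_Rintegral//; congr EFin.
rewrite (RintegralD measurableT i1 i2) (RintegralZl _ measurableT i0).
rewrite (RintegralZl _ measurableT (integrable_normal_cos c s m)).
by rewrite Rintegral_normal_pdf Rintegral_normal_cos//; ring.
Qed.

(** By [normal_pdf_mul], integrating out the jump leaves the Gaussian density of the sum times the
    conditional mean of the modulation. The conditional law has deviation [s * t / u], so the cosine
    survives only with the factor [E]. The two densities then differ by at most [2 * E] times a
    Gaussian density. *)
Lemma tvle_conv_wave s t m a b (t0 : t != 0) (a1 : `|a| <= 2^-1) (b1 : `|b| <= 2^-1) :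
  0 < s -> 0 < t ->
  tvle (conv (dlaw (normal_density s)) (dlaw (wave_density m t0 a1)))
       (conv (dlaw (normal_density s)) (dlaw (wave_density m t0 b1)))
       (2 * expR (- ((s * t) ^+ 2 / (s ^+ 2 + t ^+ 2) * m ^+ 2 / 2))).
Proof.
move=> s_gt0 t_gt0 A mA; rewrite !conv_dlaw//=.
set u := Num.sqrt (s ^+ 2 + t ^+ 2).
have st0 : 0 < s ^+ 2 + t ^+ 2 by rewrite addr_gt0// exprn_gt0.
have u2 : u ^+ 2 = s ^+ 2 + t ^+ 2 by rewrite sqr_sqrtr// ltW.
have u0 : 0 < u by rewrite sqrtr_gt0.
have r0 : 0 < s * t / u by rewrite divr_gt0// mulr_gt0.
set e := expR (- (t ^+ 2 * m ^+ 2 / 2)).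
set E := expR _.
(* The centring constant is not damped by the smoothing, but it is already smaller than [E], since
   [s^2 t^2 / (s^2 + t^2) <= t^2]. *)
have eE : e <= E.
  rewrite ler_expR lerN2 ler_wpM2r// ler_wpM2r ?sqr_ge0// ler_pdivrMr// exprMn.
  by rewrite mulrC ler_wpM2l ?sqr_ge0// lerDl sqr_ge0.
pose q a z := 1 + a * (cos (m * (t ^+ 2 / u ^+ 2 * z)) * E - e).
have inner a' z : (\int[mu]_y (normal_pdf 0 s (z - y) * wave t m a' y)%:E =
    (normal_pdf 0 u z * q a' z)%:E)%E.
  transitivity (\int[mu]_y ((normal_pdf 0 u z)%:E *
     (normal_pdf (t ^+ 2 / u ^+ 2 * z) (s * t / u) y *
      (1 + a' * (cos (m * y) - e)))%:E))%E.
    apply: eq_integral => y _; rewrite -EFinM; congr EFin.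
    by rewrite /wave mulrA (normal_pdf_mul _ _ s_gt0 t_gt0) -/u -/e mulrA.
  rewrite integralZl//; last first.
    apply: (@integrable_normal_pdfM _ _ _ _ (1 + `|a'| * (1 + `|e|))).
      apply: measurable_funD => //; apply: measurable_funM => //.
      by apply: measurable_funB => //; exact: measurable_cosM.
    move=> y; rewrite (le_trans (ler_normD _ _))// normr1 lerD2l normrM ler_wpM2l//.
    by rewrite (le_trans (ler_normB _ _))// lerD2r cos_max.
  rewrite integral_normal_wave ?gt_eqF// -EFinM; congr EFin; congr (_ * _).
  by rewrite /q /E !expr_div_n u2.
have q0 a' : `|a'| <= 2^-1 -> forall z, 0 <= normal_pdf 0 u z * q a' z.
  move=> ha z; rewrite -lee_fin -inner; apply: integral_ge0 => y _.
  by rewrite lee_fin mulr_ge0// ?normal_pdf_ge0// wave_ge0.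
have mq a' : measurable_fun setT (fun z => normal_pdf 0 u z * q a' z).
  apply: measurable_funM; first exact: measurable_normal_pdf.
  apply: measurable_funD => //; apply: measurable_funM => //.
  apply: measurable_funB => //; apply: measurable_funM => //.
  rewrite (_ : (fun z => _) = (fun z => cos ((m * (t ^+ 2 / u ^+ 2)) * z))).
    exact: measurable_cosM.
  by apply/funext => z; rewrite mulrA.
have m1 : measurable_fun setT (\1_A : R -> R) by exact: measurable_indic.
(* Spreading the error over the Gaussian density of the sum reduces the claim to a pointwise
   comparison of integrands. *)
have -> : ((2 * E)%:E = \int[mu]_z ((2 * E) * normal_pdf 0 u z)%:E)%E.
  under eq_integral do rewrite EFinM.
  by rewrite integralZl ?integral_normal_pdf ?mule1//; exact: integrable_normal_pdf.
under eq_integral do rewrite inner -EFinM.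
under [X in (_ <= X + _)%E]eq_integral do rewrite inner -EFinM.
rewrite -ge0_integralD//; first last.
- by apply/measurable_EFinP/measurable_funM => //; exact: measurable_normal_pdf.
- by move=> z _; rewrite lee_fin !mulr_ge0 ?normal_pdf_ge0// expR_ge0.
- by apply/measurable_EFinP; exact: (measurable_funM m1 (mq b)).
- by move=> z _; rewrite lee_fin mulr_ge0// q0.
apply: ge0_le_integral => //.
- by move=> z _; rewrite lee_fin mulr_ge0// q0.
- by apply/measurable_EFinP; exact: (measurable_funM m1 (mq a)).
- apply: emeasurable_funD.
    by apply/measurable_EFinP; exact: (measurable_funM m1 (mq b)).
  by apply/measurable_EFinP/measurable_funM => //; exact: measurable_normal_pdf.
move=> z _; rewrite -EFinD lee_fin.
have g0 := normal_pdf_ge0 0 u z.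
have E0 : 0 < E by exact: expR_gt0.
have e0 : 0 < e by exact: expR_gt0.
have qq : q a z <= q b z + 2 * E.
  rewrite /q; set co := cos _.
  have co1 : `|co| <= 1 by exact: cos_max.
  have ab1 : `|a - b| <= 1 by rewrite (le_trans (ler_normB _ _))//; lra.
  have coE : `|co * E - e| <= 2 * E.
    rewrite (le_trans (ler_normB _ _))// normrM (gtr0_norm E0) (gtr0_norm e0).
    by have : `|co| * E <= E; [rewrite ler_piMl// ltW|lra].
  have : `|(a - b) * (co * E - e)| <= 1 * (2 * E) by rewrite normrM ler_pM.
  by rewrite ler_norml => /andP[_]; lra.
rewrite indicE; case: (z \in A); rewrite ?mul1r ?mul0r ?add0r.
  by rewrite [2 * E * _]mulrC -mulrDr ler_wpM2l.
by rewrite !mulr_ge0// ltW.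
Qed.

End wave_tv.

(** * Sobolev norm and L2-separation of the waves *)

Section wave_norms.
Context {R : realType}.
Local Notation mu := (@lebesgue_measure R).
Implicit Types (s t x y z m a b c beta M : R).

(** With [d = x - c], one has [|x| <= M (1 + |d|) <= M expR |d|], and
    [2 beta |d| <= 2 beta^2 + d^2 / 2]. As [1 <= t], half of the exponent of the squared Gaussian
    absorbs [d^2 / 2]; the other half is a Gaussian of deviation [t^-1]. *)
Lemma powR_gauss_le beta t c M x : 0 <= beta -> 1 <= t -> 1 <= M -> `|c| <= M ->
  `|x| `^ (2 * beta) * expR (- (t ^+ 2 * (x - c) ^+ 2 / 2)) ^+ 2 <=
  M `^ (2 * beta) * expR (2 * beta ^+ 2) / normal_peak t^-1 * normal_pdf c t^-1 x.
Proof.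
move=> b0 t1 M1 cM.
have t0 : t != 0 by rewrite gt_eqF//; lra.
have b2 : 0 <= 2 * beta by lra.
have M0 : 0 <= M by lra.
set d := x - c; have d1 : 0 <= 1 + `|d| by rewrite addr_ge0.
have xd : `|x| <= M * (1 + `|d|).
  rewrite (_ : x = d + c); last by rewrite /d subrK.
  rewrite (le_trans (ler_normD _ _))// mulrDr mulr1 addrC lerD// ler_peMl//.
have -> : normal_pdf c t^-1 x = normal_peak t^-1 * expR (- (t ^+ 2 * d ^+ 2 / 2)).
  rewrite normal_pdfE ?invr_eq0// /normal_fun -/d; congr (_ * expR _).
  by rewrite exprVn; field.
rewrite -!mulrA mulKf ?gt_eqF ?normal_peak_gt0 ?invr_eq0//.
have xp : `|x| `^ (2 * beta) <= M `^ (2 * beta) * expR (2 * beta ^+ 2 + d ^+ 2 / 2).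
  apply: (@le_trans _ _ ((M * (1 + `|d|)) `^ (2 * beta))).
    by apply: ge0_ler_powR => //; rewrite nnegrE mulr_ge0.
  rewrite powRM//.
  rewrite ler_wpM2l ?powR_ge0//.
  apply: (@le_trans _ _ (expR `|d| `^ (2 * beta))).
    by apply: ge0_ler_powR => //; rewrite ?nnegrE ?expR_ge0 ?expR_ge1Dx.
  rewrite -expRM ler_expR -(real_normK (num_real d)).
  have := sqr_ge0 (2 * beta - `|d|); rewrite !expr2; lra.
apply: (le_trans (ler_wpM2r _ xp)); first by rewrite exprn_ge0// expR_ge0.
rewrite -mulrA ler_wpM2l ?powR_ge0// -expRM_natl -!expRD ler_expR.
have : d ^+ 2 <= t ^+ 2 * d ^+ 2 by rewrite ler_peMl ?sqr_ge0// expr_ge1//; lra.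
by lra.
Qed.

Lemma wave_cf_sqr_le t m a x : `|a| <= 2^-1 ->
  wave_cf t m a x ^+ 2 <= 12 * expR (- (t ^+ 2 * (x - 0) ^+ 2 / 2)) ^+ 2 +
    a ^+ 2 * (expR (- (t ^+ 2 * (x - m) ^+ 2 / 2)) ^+ 2 +
              expR (- (t ^+ 2 * (x - - m) ^+ 2 / 2)) ^+ 2).
Proof.
move=> a1; rewrite /wave_cf subr0 opprK.
set e := expR (- (t ^+ 2 * m ^+ 2 / 2)).
set p0 := expR _; set p1 := expR _; set p2 := expR _.
have e01 : 0 <= e <= 1.
  by rewrite expR_ge0 expRN_le1// divr_ge0// mulr_ge0 ?sqr_ge0.
have h : (1 - a * e) ^+ 2 <= 4.
  have : `|a * e| <= 1.
    rewrite normrM (ger0_norm (andP e01).1).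
    by rewrite (le_trans (ler_pM (normr_ge0 _) (andP e01).1 a1 (andP e01).2))//; lra.
  rewrite ler_norml => ae; rewrite expr2; nra.
(* The square of a sum of three terms is at most three times the sum of their squares; moreover
   [3 * (a / 2)^2 <= a^2]. With [(1 - a * e)^2 <= 4] this gives the constant 12. *)
apply: (@le_trans _ _ (3 * ((1 - a * e) ^+ 2 * p0 ^+ 2) +
    a ^+ 2 * (p1 ^+ 2 + p2 ^+ 2))).
  have h1 := sqr_ge0 ((1 - a * e) * p0 - a / 2 * p1).
  have h2 := sqr_ge0 ((1 - a * e) * p0 - a / 2 * p2).
  have h3 := sqr_ge0 (a / 2 * p1 - a / 2 * p2).
  have h4 := sqr_ge0 (a / 2 * p1).
  have h5 := sqr_ge0 (a / 2 * p2).
  rewrite !expr2 in h1 h2 h3 h4 h5 *; lra.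
rewrite lerD2r (_ : 12 = 3 * 4); last by lra.
by rewrite -mulrA ler_wpM2l// ler_wpM2r// sqr_ge0.
Qed.

Lemma measurable_wave_cf t m a : measurable_fun setT (wave_cf t m a).
Proof.
have mE c : measurable_fun setT (fun u : R => expR (- (t ^+ 2 * (u + c) ^+ 2 / 2))).
  apply: measurableT_comp => //; apply: measurableT_comp => //.
  apply: measurable_funM => //; apply: measurable_funM => //.
  apply: (measurable_funX 2); exact: measurable_funD.
apply: measurable_funD.
  by apply: measurable_funM => //; have := mE 0; under eq_fun do rewrite addr0.
by apply: measurable_funM => //; apply: measurable_funD; exact: mE.
Qed.

(** The central bump contributes 12 units and each translate at most 1/2, because the weight
    [m^(2 beta)] is compensated by [a^2]: hence 13. The bound is uniform in [m] and proportional to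
    [1 / t], so widening the envelope makes it as small as desired. *)
Lemma sobolev_wave_cf beta t m a : 0 <= beta -> 1 <= t -> 1 <= m ->
  `|a| <= 2^-1 -> a ^+ 2 * m `^ (2 * beta) <= 2^-1 ->
  (\int[mu]_x (`|x| `^ (2 * beta) * wave_cf t m a x ^+ 2)%:E <=
   (13 * (expR (2 * beta ^+ 2) / normal_peak t^-1))%:E)%E.
Proof.
move=> b0 t1 m1 a1 am.
have t0 : t != 0 by rewrite gt_eqF//; lra.
set K := expR (2 * beta ^+ 2) / normal_peak t^-1.
have K0 : 0 <= K by rewrite divr_ge0 ?expR_ge0 ?normal_peak_ge0.
pose N c := normal_pdf c t^-1.
have N0 c x : 0 <= N c x by exact: normal_pdf_ge0.
have Ni c : mu.-integrable setT (EFin \o N c) by exact: integrable_normal_pdf.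
have i1 := integrable_EFinD measurableT (Ni m) (Ni (- m)).
have i2 := integrable_EFinD measurableT
  (integrable_EFinZ measurableT (12 * K) (Ni 0))
  (integrable_EFinZ measurableT (2^-1 * K) i1).
have <- : (\int[mu]_x (12 * K * N 0 x + 2^-1 * K * (N m x + N (- m) x))%:E =
    (13 * K)%:E)%E.
  rewrite EFin_Rintegral//; congr EFin.
  rewrite (RintegralD measurableT (integrable_EFinZ measurableT (12 * K) (Ni 0))
    (integrable_EFinZ measurableT (2^-1 * K) i1)).
  rewrite (RintegralZl _ measurableT (Ni 0)) (RintegralZl _ measurableT i1).
  by rewrite (RintegralD measurableT (Ni m) (Ni (- m))) !Rintegral_normal_pdf; field.
apply: ge0_le_integral => //.
- by move=> x _; rewrite lee_fin mulr_ge0 ?powR_ge0 ?sqr_ge0.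
- apply/measurable_EFinP/measurable_funM.
    apply: (measurableT_comp (measurable_powR _)) => //.
  by apply: (measurable_funX 2); exact: measurable_wave_cf.
- exact: measurable_int i2.
move=> x _; rewrite lee_fin.
apply: (le_trans (ler_wpM2l (powR_ge0 _ _) (wave_cf_sqr_le t m x a1))).
rewrite mulrDr lerD//.
  rewrite [X in X <= _]mulrCA -[X in _ <= X]mulrA ler_wpM2l//.
  have := @powR_gauss_le beta t 0 1 x b0 t1 (lexx _); rewrite normr0 powR1 mul1r.
  exact.
rewrite [X in X <= _]mulrCA mulrDr.
have g c : `|c| = m ->
    `|x| `^ (2 * beta) * expR (- (t ^+ 2 * (x - c) ^+ 2 / 2)) ^+ 2 <=
    m `^ (2 * beta) * (K * N c x).
  move=> cm; have := @powR_gauss_le beta t c m x b0 t1 m1;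
    rewrite cm lexx => /(_ isT).
  by rewrite /K !mulrA.
have m0 : 0 <= m by lra.
have gm := g m (ger0_norm m0).
have gN : `|- m| = m by rewrite normrN ger0_norm.
have {g}gN := g _ gN.
apply: (@le_trans _ _ (a ^+ 2 *
    (m `^ (2 * beta) * (K * N m x) + m `^ (2 * beta) * (K * N (- m) x)))).
  by rewrite ler_wpM2l ?sqr_ge0// lerD.
rewrite [X in X <= _](_ : _ =
  a ^+ 2 * m `^ (2 * beta) * (K * (N m x + N (- m) x))); last by ring.
rewrite [X in _ <= X](_ : _ = 2^-1 * (K * (N m x + N (- m) x))); last by ring.
by rewrite ler_wpM2r// mulr_ge0// addr_ge0.
Qed.

Lemma normal_pdf_sqr t x : t != 0 ->
  normal_pdf 0 t x ^+ 2 = normal_peak t ^+ 2 / normal_peak (t / Num.sqrt 2) *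
    normal_pdf 0 (t / Num.sqrt 2) x.
Proof.
move=> t0; have s0 : t / Num.sqrt 2 != 0.
  by rewrite mulf_neq0// invr_eq0 sqrtr_eq0 -ltNge.
rewrite !normal_pdfE// exprMn -mulrA mulKf ?gt_eqF ?normal_peak_gt0//.
congr (_ * _); rewrite /normal_fun -expRM_natl; congr expR.
rewrite expr_div_n sqr_sqrtr//; field.
exact: t0.
Qed.

(** The squared Gaussian is a multiple of a Gaussian of deviation [t / sqrt 2], against which
    [(cos (m * x) - e)^2] has mean [1/2 + e^2 + E1/2 - 2 e E2]. The bound [e <= 1/8] keeps this
    above 1/4. *)
Lemma wave_separation t m a lam : 1 <= t -> 4 <= m ->
  ((lam ^+ 2 * a ^+ 2 * (normal_peak t ^+ 2 / normal_peak (t / Num.sqrt 2)) / 4)%:E <=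
   \int[mu]_x ((lam * wave t m a x - lam * wave t m 0 x) ^+ 2)%:E)%E.
Proof.
move=> t1 m4.
have t0 : t != 0 by rewrite gt_eqF//; lra.
set r := t / Num.sqrt 2.
have r0 : r != 0 by rewrite mulf_neq0// invr_eq0 sqrtr_eq0 -ltNge.
set k := normal_peak t ^+ 2 / normal_peak r.
have k0 : 0 <= k by rewrite divr_ge0 ?sqr_ge0 ?normal_peak_ge0.
set e := expR (- (t ^+ 2 * m ^+ 2 / 2)).
pose N := normal_pdf 0 r.
have Ni : mu.-integrable setT (EFin \o N) by exact: integrable_normal_pdf.
have ci c := integrable_normal_cos 0 r c.
have j1 := integrable_EFinZ measurableT (2^-1 + e ^+ 2) Ni.
have j2 := integrable_EFinZ measurableT (2^-1) (ci (2 * m)).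
have j3 := integrable_EFinZ measurableT (- 2 * e) (ci m).
have j12 := integrable_EFinD measurableT j1 j2.
have j := integrable_EFinD measurableT j12 j3.
have -> : (\int[mu]_x ((lam * wave t m a x - lam * wave t m 0 x) ^+ 2)%:E =
  (lam ^+ 2 * a ^+ 2 * k * (2^-1 + e ^+ 2 +
    2^-1 * expR (- (r ^+ 2 * (2 * m) ^+ 2 / 2))
    - 2 * e * expR (- (r ^+ 2 * m ^+ 2 / 2))))%:E)%E.
  transitivity (\int[mu]_x ((lam ^+ 2 * a ^+ 2 * k)%:E *
     ((2^-1 + e ^+ 2) * N x + 2^-1 * (N x * cos (2 * m * x)) +
      - 2 * e * (N x * cos (m * x)))%:E))%E.
    apply: eq_integral => x _; rewrite -EFinM; congr EFin.
    transitivity (lam ^+ 2 * a ^+ 2 * (cos (m * x) - e) ^+ 2 * normal_pdf 0 t x ^+ 2).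
      by rewrite /wave -/e; ring.
    rewrite (_ : 2 * m * x = (m * x) *+ 2); last by ring.
    by rewrite cos_mulr2n normal_pdf_sqr// -/r -/k -/(N x); field.
  rewrite integralZl// EFin_Rintegral// -EFinM; congr (_ * _)%:E.
  rewrite (RintegralD measurableT j12 j3) (RintegralD measurableT j1 j2).
  rewrite (RintegralZl _ measurableT Ni) !(RintegralZl _ measurableT (ci _)).
  by rewrite Rintegral_normal_pdf !Rintegral_normal_cos// !mulr0 cos0; ring.
rewrite lee_fin ler_wpM2l//.
  by rewrite mulr_ge0// mulr_ge0 ?sqr_ge0.
(* Here [4 <= m] and [1 <= t] make the exponent at least 8. *)
have e8 : e <= 8^-1.
  rewrite /e expRN lef_pV2 ?posrE ?expR_gt0//.
  apply: le_trans (expR_ge1Dx _).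
  have : 16 <= t ^+ 2 * m ^+ 2.
    by rewrite -exprMn (_ : 16 = 4 ^+ 2) ?lerXn2r ?nnegrE//; nra.
  by lra.
have e0 : 0 <= e by exact: expR_ge0.
set E1 := expR _; set E2 := expR _.
have E10 : 0 <= E1 by exact: expR_ge0.
have E20 : 0 <= E2 by exact: expR_ge0.
have E21 : E2 <= 1.
  by rewrite /E2 expRN_le1// divr_ge0// mulr_ge0 ?sqr_ge0.
by have := sqr_ge0 e; nra.
Qed.

End wave_norms.

(** * The statistical model *)

Section triplet_of_density.
Context {R : realType}.
Local Notation mu := (@lebesgue_measure R).
Variables (s lam : R) (f : pdensity R) (s0 : 0 <= s) (lam0 : 0 < lam).

Let h x := lam * f x.

Let h0 x : 0 <= h x.
Proof. by rewrite mulr_ge0 ?dens_ge0// ltW. Qed.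

Let mh : measurable_fun setT h.
Proof. by apply: measurable_funM => //; exact: measurable_dens. Qed.

Let ih : (\int[mu]_x (h x)%:E = lam%:E)%E.
Proof.
under eq_integral do rewrite EFinM.
by rewrite integralZl ?integral_dens ?mule1//; exact: integrable_dens.
Qed.

Let h_gt0 : (0 < \int[mu]_x (h x)%:E)%E. Proof. by rewrite ih lte_fin. Qed.
Let h_fin : (\int[mu]_x (h x)%:E < +oo)%E. Proof. by rewrite ih ltry. Qed.

Definition density_triplet : levy_triplet R :=
  LevyTriplet 0 s0 h0 mh h_gt0 h_fin.

Lemma intensity_density_triplet : intensity density_triplet = lam.
Proof. by rewrite /intensity /Rintegral /= ih. Qed.

Lemma jump_density_triplet x : jump_density density_triplet x = f x.
Proof.
by rewrite /jump_density intensity_density_triplet /= /h mulrC mulKf// gt_eqF.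
Qed.

Variable psi : R -> R.
Hypothesis fpsi : real_cf (dlaw f) psi.

Let int_cos t : \int[mu]_x (f x * cos (t * x)) = psi t.
Proof.
rewrite -(@Rintegral_dlaw _ f (fun x => cos (t * x)) 1); first exact: (fpsi t).1.
  exact: measurable_cosM.
by move=> x; exact: cos_max.
Qed.

Let int_sin t : \int[mu]_x (f x * sin (t * x)) = 0.
Proof.
rewrite -(@Rintegral_dlaw _ f (fun x => sin (t * x)) 1); first exact: (fpsi t).2.
  exact: measurable_sinM.
by move=> x; exact: sin_max.
Qed.

Lemma jump_charfun_triplet t : jump_charfun density_triplet t = (psi t)%:C.
Proof.
rewrite /jump_charfun /cintegral; congr (_ +i* _).
  rewrite -int_cos; apply: eq_Rintegral => x _.
  by rewrite jump_density_triplet /= expR0; ring.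
rewrite -[RHS](int_sin t); apply: eq_Rintegral => x _.
by rewrite jump_density_triplet /= expR0; ring.
Qed.

Lemma levy_charfun_triplet t : levy_charfun density_triplet t =
  (expR (- (s ^+ 2 * t ^+ 2 / 2)) * expR (lam * (psi t - 1)))%:C.
Proof.
have fi : mu.-integrable setT (EFin \o f) by exact: integrable_dens.
have ci : mu.-integrable setT (EFin \o (fun x => f x * cos (t * x))).
  apply: (@integrable_densM _ _ _ 1); first exact: measurable_cosM.
  by move=> x; exact: cos_max.
have si : mu.-integrable setT (EFin \o (fun x => f x * sin (t * x))).
  apply: (@integrable_densM _ _ _ 1); first exact: measurable_sinM.
  by move=> x; exact: sin_max.
rewrite /levy_charfun; have -> : cintegral mu (fun x => (cexp (0 +i* (t * x)) - 1) *
    (ldens density_triplet x)%:C) = (lam * (psi t - 1))%:C.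
  rewrite /cintegral; congr (_ +i* _).
    transitivity (\int[mu]_x (lam * (f x * cos (t * x) - f x))).
      by apply: eq_Rintegral => x _ /=; rewrite expR0 /h; ring.
    rewrite (RintegralZl _ measurableT (integrable_EFinB measurableT ci fi)).
    by rewrite (RintegralB measurableT ci fi) int_cos /Rintegral integral_dens.
  transitivity (\int[mu]_x (lam * (f x * sin (t * x)))).
    by apply: eq_Rintegral => x _ /=; rewrite expR0 /h; ring.
  by rewrite (RintegralZl _ measurableT si) int_sin mulr0.
rewrite /cexp /= mul0r !(subr0, addr0, oppr0, add0r).
by rewrite cos0 sin0 mulr0 mulr1 -expRD; congr (expR _ +i* _); field.
Qed.

End triplet_of_density.

Section iid_model.
Context {R : realType}.
Implicit Types P : probability R R.

Definition tcoord n (i : 'I_n) (w : n.-tuple R) : R := tnth w i.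

HB.instance Definition _ n (i : 'I_n) :=
  isMeasurableFun.Build _ _ _ _ (@tcoord n i) (@measurable_tnth _ R n i).

Definition tsample P n (i : 'I_n) : {RV (tprod P n) >-> R} := @tcoord n i.

Lemma Rintegral_tcoord P n (i : 'I_n) (h : R -> R) (M : R) :
  measurable_fun setT h -> (forall x, `|h x| <= M) ->
  \int[tprod P n]_w h (tnth w i) = \int[P]_x h x.
Proof.
move=> mh hM.
transitivity (\int[distribution (tprod P n) (@tcoord n i)]_x h x).
  rewrite /Rintegral (@integral_distribution _ _ _ _ _ (tprod P n) (@tcoord n i))//.
    exact/measurable_EFinP.
  apply: (@bounded_integrable _ _ _ (tprod P n) _ M) => //.
  by apply: (measurableT_comp mh); exact: measurable_tnth.
congr fine; apply: eq_measure_integral => A mA _.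
exact: tprod_marginal.
Qed.

Lemma iid_tsample (s lam : R) (f : pdensity R) (s0 : 0 <= s) (lam0 : 0 < lam)
    (psi : R -> R) P n :
  real_cf (dlaw f) psi ->
  real_cf P (fun t => expR (- (s ^+ 2 * t ^+ 2 / 2)) * expR (lam * (psi t - 1))) ->
  iid_sample (density_triplet f s0 lam0) (@tsample P n).
Proof.
move=> fpsi Pcf; split.
- move=> J A mA; exact: tprod_independent.
- move=> i j A mA; rewrite /distribution /pushforward.
  by rewrite (tprod_marginal P i mA) (tprod_marginal P j mA).
- move=> i t; rewrite (levy_charfun_triplet s0 lam0 fpsi) /charfun /cintegral.
  have [Pc Ps] := Pcf t.
  congr (_ +i* _).
    rewrite -Pc -(@Rintegral_tcoord P n i _ 1); last 2 first.
    - exact: measurable_cosM.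
    - by move=> x; exact: cos_max.
    by apply: eq_Rintegral => w _ /=; rewrite expR0 mul1r.
  rewrite -[RHS]Ps -(@Rintegral_tcoord P n i _ 1); last 2 first.
  - exact: measurable_sinM.
  - by move=> x; exact: sin_max.
  by apply: eq_Rintegral => w _ /=; rewrite expR0 mul1r.
Qed.

Lemma MISE_tsample T P n (est : estimator n) :
  MISE T (@tsample P n) est =
  (\int[tprod P n]_w \int[lebesgue_measure]_x
     (`|est (w, x) - ldens T x| ^+ 2)%:E)%E.
Proof.
apply: eq_integral => w _; apply: eq_integral => x _.
by congr (`|est (_, x) - _| ^+ 2)%:E; apply: eq_from_tnth => i; rewrite tnth_mktuple.
Qed.

Lemma measurable_ise (T : levy_triplet R) n (est : estimator n) :
  measurable_fun setT (fun w : n.-tuple R => \int[lebesgue_measure]_x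
     (`|est (w, x) - ldens T x| ^+ 2)%:E)%E.
Proof.
apply: (measurable_fun_fubini_tonelli_F (m2 := lebesgue_measure)
  (fun z : n.-tuple R * R => (`|est z - ldens T z.2| ^+ 2)%:E)).
  apply/measurable_EFinP; apply: (measurable_funX 2); apply: measurableT_comp => //.
  apply: measurable_funB; first exact: (measurable_funPT est).
  have mT : @measurable_fun _ _ (measurableTypeR R) R setT (ldens T).
    exact: ldens_measurable.
  exact: (measurableT_comp mT measurable_snd).
by move=> z; rewrite lee_fin sqr_ge0.
Qed.

(** One factor 1/2 is lost in turning the distance between the hypotheses into a lower bound on the
    sum of the two losses, and another in [le_cam]; hence [D / 4]. *)
Lemma le_cam_MISE (T1 T2 : levy_triplet R) P1 P2 n (est : estimator n) (D e : R) :
  0 <= D -> 0 <= e -> tvle P2 P1 e ->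
  (D%:E <= \int[lebesgue_measure]_x ((ldens T1 x - ldens T2 x) ^+ 2)%:E)%E ->
  (((1 - n%:R * e) * (D / 4))%:E <=
    MISE T1 (@tsample P1 n) est + MISE T2 (@tsample P2 n) est)%E.
Proof.
move=> D0 e0 P21 D12; rewrite !MISE_tsample.
rewrite (_ : D / 4 = D / 2 / 2); last by field.
have D2 : 0 <= D / 2 by rewrite divr_ge0.
pose u (T : levy_triplet R) w :=
  (\int[lebesgue_measure]_x (`|est (w, x) - ldens T x| ^+ 2)%:E)%E.
apply: (@le_cam _ _ _ (tprod P1 n) (tprod P2 n) (u T1) (u T2)
  (D / 2) (n%:R * e)) => //.
- exact: tvle_tprod.
- exact: measurable_ise.
- exact: measurable_ise.
- by move=> w; apply: integral_ge0 => x _; rewrite lee_fin sqr_ge0.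
- by move=> w; apply: integral_ge0 => x _; rewrite lee_fin sqr_ge0.
move=> w.
have mT (T : levy_triplet R) :
    measurable_fun setT (fun x => `|est (w, x) - ldens T x| ^+ 2).
  apply: (measurable_funX 2); apply: measurableT_comp => //.
  apply: measurable_funB; last exact: ldens_measurable.
  exact: measurableT_comp.
rewrite /u -ge0_integralD//; last 2 first.
- by apply/measurable_EFinP; exact: mT.
- by apply/measurable_EFinP; exact: mT.
apply: (@le_trans _ _ ((2^-1)%:E *
    \int[lebesgue_measure]_x ((ldens T1 x - ldens T2 x) ^+ 2)%:E)%E).
  by rewrite mulrC EFinM lee_wpmul2l// lee_fin.
have mD : measurable_fun setT (fun x => (ldens T1 x - ldens T2 x) ^+ 2).
  by apply: (measurable_funX 2); apply: measurable_funB; exact: ldens_measurable.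
rewrite -ge0_integralZl//; last 2 first.
- exact/measurable_EFinP.
- by move=> x _; rewrite lee_fin sqr_ge0.
apply: ge0_le_integral => //.
- by move=> x _; rewrite -EFinM lee_fin mulr_ge0 ?sqr_ge0.
- by apply/measurable_EFinP; apply: measurable_funM.
- by apply: emeasurable_funD; apply/measurable_EFinP; exact: mT.
move=> x _; rewrite -EFinM -EFinD lee_fin !real_normK ?num_real//.
(* Parallelogram identity: the sum of the two squared errors exceeds half the squared difference of
   the densities by half of this square. *)
have := sqr_ge0 ((est (w, x) - ldens T1 x) + (est (w, x) - ldens T2 x)).
by rewrite !expr2; lra.
Qed.

End iid_model.

Section levy_law.
Context {R : realType}.
Implicit Types (s lam beta : R) (f : pdensity R).
Local Notation mu := (@lebesgue_measure R).

(** Law of a Gaussian variable plus a Poisson number of independent jumps. Taking the Gaussian law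
    as the base of the convolution powers places the smoothing factor in every term of the
    mixture. *)
Definition levy_law s lam (lam0 : 0 < lam) f : probability R R :=
  poisson_mix lam0 (convpow (dlaw (normal_density s)) (dlaw f)).

Lemma real_cf_levy_law s lam (lam0 : 0 < lam) f (psi : R -> R) : s != 0 ->
  real_cf (dlaw f) psi ->
  real_cf (levy_law s lam0 f)
    (fun t => expR (- (s ^+ 2 * t ^+ 2 / 2)) * expR (lam * (psi t - 1))).
Proof.
move=> s0 fpsi; apply: real_cf_poisson_mix => k.
exact: real_cf_convpow (real_cf_normal s0) fpsi.
Qed.

Lemma tvle_levy_law s lam (lam0 : 0 < lam) f g (e : R) : 0 <= e ->
  tvle (conv (dlaw (normal_density s)) (dlaw f))
       (conv (dlaw (normal_density s)) (dlaw g)) e ->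
  tvle (levy_law s lam0 f) (levy_law s lam0 g) (expR lam * e).
Proof.
by move=> e0 fg; apply: tvle_poisson_mix => // k; exact: tvle_convpow.
Qed.

Lemma le_sup_MISE (F : set (levy_triplet R)) (T : levy_triplet R)
    (P : probability R R) n (est : estimator n) :
  F T -> iid_sample T (@tsample _ P n) ->
  (MISE T (@tsample _ P n) est <= sup_MISE F est)%E.
Proof.
move=> FT TP; apply: ereal_sup_ubound.
by exists T, _, (n.-tuple R : measurableType _), (tprod P n), (@tsample _ P n).
Qed.

Lemma triplet_class_density (Gamma Sigma Lambda C beta : R) f (psi : R -> R)
    (Sigma0 : 0 < Sigma) (Lambda0 : 0 < Lambda) : 0 <= Gamma ->
  real_cf (dlaw f) psi ->
  (\int[mu]_x (`|x| `^ (2 * beta) * psi x ^+ 2)%:E <= C%:E)%E ->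
  triplet_class Gamma Sigma Lambda C beta
    (density_triplet f (ltW Sigma0) Lambda0).
Proof.
move=> G0 fpsi fC; split.
- by rewrite normr0.
- by rewrite /= Sigma0 lexx.
- by rewrite intensity_density_triplet Lambda0 lexx.
apply: le_trans fC; rewrite le_eqVlt; apply/orP; left; apply/eqP.
apply: eq_integral => t _; rewrite (jump_charfun_triplet _ _ fpsi).
by rewrite /= expr0n addr0 sqrtr_sqr real_normK ?num_real.
Qed.

Lemma normal_peakV_inv (t : R) : 0 < t ->
  (normal_peak t^-1)^-1 = Num.sqrt (pi *+ 2) / t.
Proof.
move=> t0; rewrite /normal_peak invrK -mulrnAr sqrtrM ?sqr_ge0//.
by rewrite sqrtr_sqr gtr0_norm ?invr_gt0// mulrC.
Qed.

End levy_law.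

(** * Choice of the parameters and conclusion *)

Theorem theorem4p1 (R : realType) (Gamma Sigma Lambda C beta : R)
    (hGamma : 0 < Gamma) (hSigma : 0 < Sigma) (hLambda : 0 < Lambda)
    (hC : 0 < C) (hbeta : 2^-1 <= beta) :
  exists (c : R) (n0 : nat), 0 < c /\
    forall n : nat, (n0 <= n)%N ->
      ((c * (ln n%:R) `^ (- beta))%:E
        <= minimax_MISE (triplet_class Gamma Sigma Lambda C beta) n)%E.
Proof.
have b0 : 0 <= beta by lra.
(* The Sobolev bound equals [A / t], and this [t] ensures both [A / t <= C] and [1 <= t]. *)
pose A := 13 * expR (2 * beta ^+ 2) * Num.sqrt (pi *+ 2) : R.
pose t := 1 + A / C.
have A0 : 0 <= A by rewrite !mulr_ge0 ?expR_ge0.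
have t1 : 1 <= t by rewrite lerDl divr_ge0// ltW.
have tp : 0 < t by lra.
have t0 : t != 0 by rewrite gt_eqF.
have tC : 13 * (expR (2 * beta ^+ 2) / normal_peak t^-1) <= C.
  rewrite normal_peakV_inv// [leLHS](_ : _ = A / t); last by rewrite /A; ring.
  rewrite ler_pdivrMr// (_ : C * t = C + A).
    by rewrite lerDr ltW.
  by rewrite /t; field; rewrite gt_eqF.
pose v := (Sigma * t) ^+ 2 / (Sigma ^+ 2 + t ^+ 2).
have v0 : 0 < v by rewrite divr_gt0 ?addr_gt0 ?exprn_gt0 ?mulr_gt0.
(* The squared L2-norm of the Gaussian envelope. *)
pose kappa := normal_peak t ^+ 2 / normal_peak (t / Num.sqrt 2) : R.
have kappa0 : 0 < kappa.
  rewrite divr_gt0 ?exprn_gt0 ?normal_peak_gt0//.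
  by rewrite mulf_neq0// invr_eq0 sqrtr_eq0 -ltNge.
(* The constant is chosen so that the claimed bound equals [D / 16] for the separation [D] below:
   256 is the product of 4 from [a^2], 4 from [D] and 16. *)
pose c := Lambda ^+ 2 * kappa / 256 * (4 / v) `^ (- beta).
have c0 : 0 < c.
  apply: mulr_gt0; last by rewrite powR_gt0// divr_gt0.
  by apply: divr_gt0 => //; apply: mulr_gt0 => //; exact: exprn_gt0.
(* The first summand of the threshold gives [16 <= y], hence [4 <= m]; the second bounds the total
   variation between the samples by 1/2. *)
exists c, (Num.truncn (expR (4 * v) + 4 * expR Lambda)).+1; split => // n n0n.
have nX : expR (4 * v) + 4 * expR Lambda <= n%:R.
  by rewrite ltW// (lt_le_trans (truncnS_gt _))// ler_nat.
have n0 : 0 < n%:R :> R.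
  by rewrite (lt_le_trans _ nX)// addr_gt0 ?mulr_gt0 ?expR_gt0.
have n4v : 4 * v <= ln n%:R.
  rewrite -(expRK (4 * v)) ler_ln ?posrE ?expR_gt0//.
  by rewrite (le_trans _ nX)// lerDl mulr_ge0// expR_ge0.
have ln0 : 0 <= ln n%:R :> R by rewrite (le_trans _ n4v)// mulr_ge0// ltW.
have nL : 4 * expR Lambda <= n%:R.
  by rewrite (le_trans _ nX)// lerDr expR_ge0.
(* With [m^2 = y] the damping [expR (- (v * m^2 / 2))] is [n^(-2)]: one power of [n] pays for the
   [n] observations, the other makes the error tend to 0. *)
pose y := 4 / v * ln n%:R.
have y16 : 16 <= y.
  by rewrite /y mulrAC ler_pdivlMr//; lra.
have y0 : 0 < y by lra.
pose m := Num.sqrt y.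
have m2 : m ^+ 2 = y by rewrite sqr_sqrtr// ltW.
have m4 : 4 <= m.
  rewrite (_ : 4 = Num.sqrt (4 ^+ 2)); last by rewrite sqrtr_sqr ger0_norm.
  by rewrite ler_wsqrtr//; lra.
(* This is [m^(-beta) / 2], so that [a^2 m^(2 beta) = 1/4]. *)
pose a := 2^-1 * y `^ (- (beta / 2)).
have a2 : a ^+ 2 = 4^-1 * y `^ (- beta).
  rewrite exprMn -[_ `^ _ ^+ 2]powR_mulrn ?powR_ge0// -powRrM.
  by congr (_ * _ `^ _); field.
have a1 : `|a| <= 2^-1.
  rewrite ger0_norm ?mulr_ge0 ?powR_ge0// ler_piMr// powRN invf_le1 ?powR_gt0//.
  by rewrite -[leLHS](powRr0 y) ler_powR//; lra.
have am : a ^+ 2 * m `^ (2 * beta) <= 2^-1.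
  rewrite powRrM powR_mulrn ?sqrtr_ge0// m2 a2 -mulrA -powRD; last first.
    by apply/implyP => _; rewrite gt_eqF.
  by rewrite addNr powRr0; lra.
(* The unperturbed hypothesis is the wave of amplitude 0, so the same lemmas cover both
   hypotheses. *)
have z1 : `|0 : R| <= 2^-1 by rewrite normr0.
have zm : 0 ^+ 2 * m `^ (2 * beta) <= 2^-1 by rewrite expr0n/= mul0r invr_ge0.
pose fa := wave_density m t0 a1; pose fz := wave_density m t0 z1.
have s0 : Sigma != 0 by rewrite gt_eqF.
have cfa := real_cf_wave m t0 a1; have cfz := real_cf_wave m t0 z1.
pose Ta := density_triplet fa (ltW hSigma) hLambda.
pose Tz := density_triplet fz (ltW hSigma) hLambda.
pose Pa := levy_law Sigma hLambda fa; pose Pz := levy_law Sigma hLambda fz.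
have m1 : 1 <= m by lra.
have Fa : triplet_class Gamma Sigma Lambda C beta Ta.
  apply: triplet_class_density cfa _; first exact: ltW.
  by apply: le_trans (sobolev_wave_cf b0 t1 m1 a1 am) _; rewrite lee_fin.
have Fz : triplet_class Gamma Sigma Lambda C beta Tz.
  apply: triplet_class_density cfz _; first exact: ltW.
  by apply: le_trans (sobolev_wave_cf b0 t1 m1 z1 zm) _; rewrite lee_fin.
have Sa : iid_sample Ta (@tsample _ Pa n).
  by apply: (@iid_tsample _ _ _ _ (ltW hSigma) hLambda _ Pa n cfa);
    exact: (real_cf_levy_law hLambda s0 cfa).
have Sz : iid_sample Tz (@tsample _ Pz n).
  by apply: (@iid_tsample _ _ _ _ (ltW hSigma) hLambda _ Pz n cfz);
    exact: (real_cf_levy_law hLambda s0 cfz).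
pose d := 2 * expR (- (v * m ^+ 2 / 2)).
have d0 : 0 <= d by rewrite mulr_ge0 ?expR_ge0.
have tv : tvle Pz Pa (expR Lambda * d).
  by apply: tvle_levy_law => //; exact: tvle_conv_wave.
have nd : n%:R * (expR Lambda * d) <= 2^-1.
  have dE : d = 2 / n%:R ^+ 2.
    rewrite /d m2 /y (_ : v * _ / 2 = 2 * ln n%:R); last first.
      by field; rewrite gt_eqF.
    by rewrite expRN expRM_natl lnK.
  rewrite dE (_ : _ * _ = 2 * expR Lambda / n%:R); last by field; rewrite gt_eqF.
  by rewrite ler_pdivrMr//; lra.
pose D := Lambda ^+ 2 * a ^+ 2 * kappa / 4.
have D0 : 0 <= D.
  by rewrite divr_ge0//; apply: mulr_ge0 (ltW kappa0); rewrite mulr_ge0 ?sqr_ge0.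
have cD : c * ln n%:R `^ (- beta) = D / 16.
  rewrite /c /D a2 /y [(_ / _ * _) `^ _]powRM//; first by field.
  by rewrite divr_ge0// ltW.
apply: le_ereal_inf_tmp => _ [est _ <-].
have := @le_cam_MISE R Ta Tz Pa Pz n est D _ D0 (mulr_ge0 (expR_ge0 _) d0) tv
  (wave_separation a Lambda t1 m4).
have Ma := le_sup_MISE est Fa Sa; have Mz := le_sup_MISE est Fz Sz.
(* If the worst risk were below [D / 16], the two risks would sum to less than [D / 8], whereas a
   total variation error of at most 1/2 forces at least [(1 - 1/2) * (D / 4)]. *)
apply: contraTT; rewrite -!ltNge cD => lt.
apply: (@lt_le_trans _ _ (D / 16 + D / 16)%:E).
  by rewrite EFinD lteD ?(le_lt_trans Ma) ?(le_lt_trans Mz).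
rewrite lee_fin; nra.
Qed.
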